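(* Let $K^*$ denote the group of invertible elements of the field $K$. Then (i) $\mathrm{N}(L_{m,1})\cong K^*$; (ii) $\mathrm{N}(L_{2,2})\cong K^*\ltimes \mathrm{Inn}(L_{2,2})$; (iii) $\mathrm{N}(L_{2,3})\cong K^*\ltimes \mathrm{GInn}(L_{2,3})$; (iv) $\mathrm{N}(L_{m,c})=\mathrm{GInn}(L_{m,c})$ whenever $m\ge 3$, $c\ge 2$ or $m=2$, $c\ge 4$.
   Context: $K$ is a field of characteristic $0$, and $m\ge 2$, $c\ge 1$ are integers. $L_m$ is the free Lie algebra over $K$ with free generators $y_1,\ldots,y_m$, and $L_{m,c}=L_m/(L_m''+L_m^{c+1})$ is the free metabelian nilpotent of class $c$ Lie algebra, where $L_m''=[[L_m,L_m],[L_m,L_m]]$ and $L_m^{k}$ is the $k$-th term of the lower central series ($L_m^1=L_m$). Its free generators are $x_i=y_i+(L_m''+L_m^{c+1})$, $i=1,\ldots,m$. The operator $\mathrm{ad}\,v$ acts on the right: $u(\mathrm{ad}\,v)=[u,v]$. The operators $\mathrm{ad}\,x_1,\ldots,\mathrm{ad}\,x_m$ commute when acting on $L_{m,c}'=[L_{m,c},L_{m,c}]$, so $K[\mathrm{ad}\,x_1,\ldots,\mathrm{ad}\,x_m]$ denotes polynomials in these commuting operators, acting on the right on $L_{m,c}'$. $\mathrm{N}(L_{m,c})$ is the group of normal automorphisms, i.e. automorphisms $\varphi$ with $\varphi(I)=I$ for every ideal $I$. $\mathrm{Inn}(L_{m,c})$ is the group of inner automorphisms $\exp(\mathrm{ad}\,v)=\sum_{k\ge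 0}\mathrm{ad}^k v/k!$, $v\in L_{m,c}$. $\mathrm{GInn}(L_{m,c})$ is the group of generalized inner automorphisms, i.e. automorphisms of the form $x_i\mapsto x_i+\sum_{j=1}^{m}[x_i,x_j]f_j$, $i=1,\ldots,m$, with $f_j\in K[\mathrm{ad}\,x_1,\ldots,\mathrm{ad}\,x_m]$ (the same $f_1,\ldots,f_m$ for all $i$). $K^*\ltimes H$ denotes the semidirect product with normal factor $H$; here $\alpha\in K^*$ is identified with the automorphism $x_i\mapsto \alpha x_i$ ($i=1,\ldots,m$) and acts on $H$ by conjugation. *)

(* Defs.v *)
(* Classical axioms are used to form quotients by undecidable congruences and
   ideals, and to compare automorphisms extensionally. *)
From HB Require Import structures.
From mathcomp Require Import all_boot all_order all_algebra.
From mathcomp Require Import boolp classical_sets functions.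
From mathcomp Require Import mpoly.

Set Implicit Arguments.
Unset Strict Implicit.
Unset Printing Implicit Defensive.

Import GRing.Theory.
Local Open Scope quotient_scope.
Local Open Scope classical_set_scope.
Local Open Scope ring_scope.

Reserved Notation "[lie u , v ]" (at level 0, format "[lie  u ,  v ]").

HB.mixin Record Lmodule_isLie (K : fieldType) L of GRing.Lmodule K L := {
  lieb : L -> L -> L;
  lieb_linearl : forall v, linear (lieb^~ v);
  lieb_linearr : forall u, linear (lieb u);
  liebvv : forall u, lieb u u = 0;
  lieb_jacobi : forall u v w,
    lieb u (lieb v w) + lieb v (lieb w u) + lieb w (lieb u v) = 0
}.

#[short(type="lieAlgType")]
HB.structure Definition LieAlgebra (K : fieldType) :=
  {L of Lmodule_isLie K L & GRing.Lmodule K L}.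

Notation "[lie u , v ]" := (lieb u v) : ring_scope.

Section LieTheory.
Variables (K : fieldType) (L : lieAlgType K).
Implicit Types (u v w : L) (A B I : set L).

Lemma liebDl u u' v : [lie u + u', v] = [lie u, v] + [lie u', v].
Proof. by have := lieb_linearl v 1 u u'; rewrite /= !scale1r. Qed.

Lemma liebDr u v v' : [lie u, v + v'] = [lie u, v] + [lie u, v'].
Proof. by have := lieb_linearr u 1 v v'; rewrite /= !scale1r. Qed.

Lemma lieb0l v : [lie 0, v] = 0.
Proof. by apply: (addrI [lie 0, v]); rewrite -liebDl !addr0. Qed.

Lemma lieb0r u : [lie u, 0] = 0.
Proof. by apply: (addrI [lie u, 0]); rewrite -liebDr !addr0. Qed.

Lemma liebZl a u v : [lie a *: u, v] = a *: [lie u, v].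
Proof. by have := lieb_linearl v a u 0; rewrite /= !addr0 lieb0l addr0. Qed.

Lemma liebZr a u v : [lie u, a *: v] = a *: [lie u, v].
Proof. by have := lieb_linearr u a v 0; rewrite /= !addr0 lieb0r addr0. Qed.

Lemma liebC u v : [lie u, v] = - [lie v, u].
Proof.
apply/eqP; rewrite -addr_eq0; apply/eqP.
by have := liebvv (u + v); rewrite liebDl !liebDr !liebvv add0r addr0.
Qed.

Lemma liebNl u v : [lie - u, v] = - [lie u, v].
Proof. by rewrite -scaleN1r liebZl scaleN1r. Qed.

Lemma liebNr u v : [lie u, - v] = - [lie u, v].
Proof. by rewrite -scaleN1r liebZr scaleN1r. Qed.

Lemma lieb_leibniz u v w :
  [lie [lie u, v], w] = [lie [lie u, w], v] + [lie u, [lie v, w]].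
Proof.
apply/eqP; rewrite -subr_eq0 opprD addrA; apply/eqP.
have := lieb_jacobi u v w => /(congr1 -%R); rewrite oppr0 => <-.
rewrite [[lie [lie u, v], w]]liebC [[lie [lie u, w], v]]liebC opprK.
rewrite [[lie u, w]]liebC liebNr !opprD.
by rewrite [LHS]addrC [- _ - [lie v, _]]addrC addrA [LHS]addrAC -!addrA
  [- [lie w, _] + _]addrC.
Qed.

(** [ad v] acts on the right: [u (ad v) = [u, v]]. *)
Definition ad v : L -> L := fun u => [lie u, v].

Definition subspace (S : set L) : Prop :=
  S 0 /\ forall (a : K) u v, S u -> S v -> S (a *: u + v).

Definition lie_ideal (I : set L) : Prop :=
  subspace I /\ forall u v, I u -> I [lie u, v].

Definition bracket_space A B : set L :=
  smallest subspace [set [lie u, v] | u in A & v in B].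

Definition derived A : set L := bracket_space A A.

(** [lcs k] is the [k]-th term of the lower central series for [k >= 1],
    starting with [lcs 1 = L]. *)
Definition lcs (k : nat) : set L :=
  iter k.-1 (fun A => bracket_space A [set: L]) [set: L].

(** [L'' + L^(c+1)] *)
Definition metab_nilp_set (c : nat) : set L :=
  [set u + v | u in derived (derived [set: L]) & v in lcs c.+1].

Lemma subspace_smallest A : subspace (smallest subspace A).
Proof.
rewrite /subspace /smallest; split=> [S [[S0 _] _] //|a u v Au Av S CS].
by case: (CS) => -[_ Slin] _; apply: Slin; [apply: Au | apply: Av].
Qed.

Lemma lie_idealT : lie_ideal [set: L]. Proof. by split=> [|u v _]; first split. Qed.

Lemma lie_ideal_bracket A B :
  lie_ideal A -> lie_ideal B -> lie_ideal (bracket_space A B).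
Proof.
move=> [_ idA] [_ idB]; have sAB := subspace_smallest
  [set [lie u, v] | u in A & v in B].
split=> // u v; rewrite -/(bracket_space A B).
pose S := [set u | bracket_space A B [lie u, v]].
suff: bracket_space A B `<=` S by apply.
apply: smallest_sub.
  split=> [|a x y Sx Sy]; rewrite /S /= ?lieb0l; first exact: sAB.1.
  by rewrite liebDl liebZl; apply: sAB.2.
move=> _ [x Ax [y By <-]]; rewrite /S /= lieb_leibniz.
rewrite -[[lie [lie x, v], y]]scale1r; apply: sAB.2; apply: sub_gen_smallest.
  by exists [lie x, v]; [exact: idA | exists y].
by exists x => //; exists [lie y, v] => //; exact: idB.
Qed.

Lemma lie_ideal_add A B :
  lie_ideal A -> lie_ideal B -> lie_ideal [set u + v | u in A & v in B].
Proof.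
move=> [[A0 Al] idA] [[B0 Bl] idB]; split; first split.
- by exists 0 => //; exists 0; rewrite ?addr0.
- move=> a _ _ [u Au [v Bv <-]] [u' Au' [v' Bv' <-]].
  exists (a *: u + u'); first exact: Al.
  by exists (a *: v + v'); [exact: Bl | rewrite scalerDr addrACA].
- move=> _ w [u Au [v Bv <-]]; rewrite liebDl.
  by exists [lie u, w]; [exact: idA | exists [lie v, w] => //; exact: idB].
Qed.

Lemma lie_ideal_lcs k : lie_ideal (lcs k).
Proof.
rewrite /lcs; elim: k.-1 => [|n IHn] /=; first exact: lie_idealT.
by apply: lie_ideal_bracket => //; exact: lie_idealT.
Qed.

Lemma lie_ideal_metab_nilp c : lie_ideal (metab_nilp_set c).
Proof.
apply: lie_ideal_add; last exact: lie_ideal_lcs.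
by do 2!apply: lie_ideal_bracket => //; apply: lie_ideal_bracket => //;
  exact: lie_idealT.
Qed.

Record ideal := Ideal { ideal_set :> L -> Prop; _ : lie_ideal ideal_set }.

Lemma idealP (I : ideal) : lie_ideal I. Proof. by case: I. Qed.

Definition metab_nilp (c : nat) : ideal := Ideal (lie_ideal_metab_nilp c).

End LieTheory.

Section Morphisms.
Variables (K : fieldType).

Definition lie_hom (L M : lieAlgType K) (f : L -> M) : Prop :=
  linear f /\ forall u v, f [lie u, v] = [lie f u, f v].

Lemma lie_hom_comp (L M P : lieAlgType K) (f : M -> P) (g : L -> M) :
  lie_hom f -> lie_hom g -> lie_hom (f \o g).
Proof.
by move=> [lf bf] [lg bg]; split=> [a u v|u v] /=; rewrite ?lg ?lf ?bg ?bf.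
Qed.

Section Image.
Variables (L M : lieAlgType K) (f : L -> M).
Hypothesis fhom : lie_hom f.

Lemma lie_homD u v : f (u + v) = f u + f v.
Proof. by have := fhom.1 1 u v; rewrite !scale1r. Qed.

Lemma lie_hom0 : f 0 = 0.
Proof. by apply: (addrI (f 0)); rewrite -lie_homD !addr0. Qed.

Lemma lie_homZ a u : f (a *: u) = a *: f u.
Proof. by have := fhom.1 a u 0; rewrite !addr0 lie_hom0 addr0. Qed.

Lemma lie_homB u v : f (u - v) = f u - f v.
Proof. by rewrite -scaleN1r lie_homD lie_homZ scaleN1r. Qed.

Lemma bracket_space_hom (A B : set L) (A' B' : set M) :
  (forall u, A u -> A' (f u)) -> (forall u, B u -> B' (f u)) ->
  forall u, bracket_space A B u -> bracket_space A' B' (f u).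
Proof.
move=> fA fB u ABu; pose S := [set u | bracket_space A' B' (f u)].
suff: bracket_space A B `<=` S by apply.
have sAB := subspace_smallest [set [lie u, v] | u in A' & v in B'].
apply: smallest_sub.
  split=> [|a x y Sx Sy]; rewrite /S /= ?lie_hom0; first exact: sAB.1.
  by rewrite fhom.1; apply: sAB.2.
move=> _ [x Ax [y By <-]]; rewrite /S /= fhom.2; apply: sub_gen_smallest.
by exists (f x); [exact: fA | exists (f y) => //; exact: fB].
Qed.

Lemma metab_nilp_hom c u : metab_nilp L c u -> metab_nilp M c (f u).
Proof.
move=> [v Lv [w Lw <-]]; rewrite lie_homD; exists (f v).
  by move: v Lv; do 2!apply: bracket_space_hom.
exists (f w) => //; rewrite /lcs /= in Lw *; elim: c w Lw => //= c IHc w Lw.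
by move: w Lw; exact: bracket_space_hom.
Qed.

End Image.
End Morphisms.

Section Quotient.
Variables (K : fieldType) (L : lieAlgType K) (I : ideal L).

Definition ideal_pred : {pred L} := fun u => `[< I u >].

Lemma ideal_pred_zmod : zmod_closed ideal_pred.
Proof.
have [[I0 Il] _] := idealP I; split=> [|u v]; rewrite !unfold_in.
  exact/asboolP.
move=> /asboolP Iu /asboolP Iv; apply/asboolP.
by rewrite addrC -scaleN1r; exact: Il.
Qed.

HB.instance Definition _ :=
  GRing.isZmodClosed.Build L ideal_pred ideal_pred_zmod.

Definition lie_quot : Type := Quotient.quot (ideal_pred : zmodClosed L).
HB.instance Definition _ := GRing.Zmodule.on lie_quot.

Definition quot_pi : L -> lie_quot := \pi_(Quotient.quot (ideal_pred : zmodClosed L)).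
Definition quot_repr : lie_quot -> L := @repr _ (Quotient.quot (ideal_pred : zmodClosed L)).

Lemma quot_reprK : cancel quot_repr quot_pi. Proof. exact: reprK. Qed.

Lemma quot_piP u v : quot_pi u = quot_pi v <-> I (u - v).
Proof.
rewrite /quot_pi; split=> [/eqP|Iuv]; last apply/eqP;
  rewrite -Quotient.idealrBE unfold_in; [by move/asboolP | exact/asboolP].
Qed.

Lemma quot_piD u v : quot_pi (u + v) = quot_pi u + quot_pi v.
Proof. exact: raddfD. Qed.

Definition quot_scale (a : K) (x : lie_quot) : lie_quot :=
  quot_pi (a *: quot_repr x).
Definition quot_lieb (x y : lie_quot) : lie_quot :=
  quot_pi [lie quot_repr x, quot_repr y].

Lemma quot_pi_repr u : I (quot_repr (quot_pi u) - u).
Proof. by apply/quot_piP; rewrite quot_reprK. Qed.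

Lemma quot_piZ a u : quot_pi (a *: u) = quot_scale a (quot_pi u).
Proof.
apply/esym/quot_piP; rewrite -scalerBr -[X in ideal_set _ X]addr0.
have [[I0 Il] _] := idealP I; exact: Il (quot_pi_repr u) I0.
Qed.

Lemma quot_pi_lieb u v :
  quot_pi [lie u, v] = quot_lieb (quot_pi u) (quot_pi v).
Proof.
have [[I0 Il] idI] := idealP I; apply/esym/quot_piP.
set u' := quot_repr _; set v' := quot_repr _.
have -> : [lie u', v'] - [lie u, v] =
    1 *: [lie u' - u, v'] + (-1 *: [lie v' - v, u] + 0).
  rewrite scale1r scaleN1r addr0 -(liebC u (v' - v)) liebDl liebNl liebDr liebNr.
  by rewrite addrA subrK.
by apply: (Il); [|apply: (Il) => //]; apply: idI; exact: quot_pi_repr.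
Qed.

Lemma quot_scaleA a b x :
  quot_scale a (quot_scale b x) = quot_scale (a * b) x.
Proof. by rewrite -[x]quot_reprK -!quot_piZ scalerA. Qed.
Lemma quot_scale1 : left_id 1 quot_scale.
Proof. by move=> x; rewrite -[x]quot_reprK -!quot_piZ scale1r. Qed.
Lemma quot_scaleDr : right_distributive quot_scale +%R.
Proof.
move=> a x y; rewrite -[x]quot_reprK -[y]quot_reprK.
by rewrite -!(quot_piZ, quot_piD) scalerDr.
Qed.
Lemma quot_scaleDl x : {morph quot_scale^~ x : a b / a + b}.
Proof.
by move=> a b; rewrite -[x]quot_reprK -!(quot_piZ, quot_piD) scalerDl.
Qed.

HB.instance Definition _ := GRing.Zmodule_isLmodule.Build K lie_quot
  quot_scaleA quot_scale1 quot_scaleDr quot_scaleDl.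

Lemma quot_pi_scale a u : quot_pi (a *: u) = a *: quot_pi u.
Proof. exact: quot_piZ. Qed.

Lemma quot_lieb_linearl y : linear (quot_lieb^~ y).
Proof.
move=> a x x' /=; rewrite -[x]quot_reprK -[x']quot_reprK -[y]quot_reprK.
by rewrite -!(quot_pi_scale, quot_piD, quot_pi_lieb) liebDl liebZl.
Qed.
Lemma quot_lieb_linearr x : linear (quot_lieb x).
Proof.
move=> a y y' /=; rewrite -[x]quot_reprK -[y']quot_reprK -[y]quot_reprK.
by rewrite -!(quot_pi_scale, quot_piD, quot_pi_lieb) liebDr liebZr.
Qed.
Lemma quot_liebvv x : quot_lieb x x = 0.
Proof.
by rewrite -[x]quot_reprK -quot_pi_lieb liebvv; exact: raddf0.
Qed.
Lemma quot_lieb_jacobi x y z :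
  quot_lieb x (quot_lieb y z) + quot_lieb y (quot_lieb z x) +
  quot_lieb z (quot_lieb x y) = 0.
Proof.
rewrite -[x]quot_reprK -[z]quot_reprK -[y]quot_reprK.
by rewrite -!(quot_pi_lieb, quot_piD) lieb_jacobi; exact: raddf0.
Qed.

HB.instance Definition _ := Lmodule_isLie.Build K lie_quot
  quot_lieb_linearl quot_lieb_linearr quot_liebvv quot_lieb_jacobi.

Lemma quot_pi_hom : lie_hom quot_pi.
Proof.
by split=> [a u v|u v]; [rewrite quot_piD quot_pi_scale | exact: quot_pi_lieb].
Qed.

End Quotient.

Lemma quot_lift_hom (K : fieldType) (L M : lieAlgType K) (I : ideal L)
    (f : L -> M) :
  lie_hom f -> (forall u, I u -> f u = 0) ->
  exists2 g : lie_quot I -> M, lie_hom g & forall u, g (quot_pi I u) = f u.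
Proof.
move=> fhom fI; pose g (x : lie_quot I) := f (quot_repr x).
have gE u : g (quot_pi I u) = f u.
  apply/eqP; rewrite -subr_eq0 /g -(lie_homB fhom); apply/eqP/fI.
  exact: quot_pi_repr.
exists g => //; split=> [a x y|x y];
  rewrite -[x]quot_reprK -[y]quot_reprK.
- by rewrite -(quot_pi_hom I).1 !gE fhom.1.
- by rewrite -(quot_pi_hom I).2 !gE fhom.2.
Qed.

(** It is built as the algebra of all terms in the operations of a Lie algebra
    and the generators [y_i], modulo the congruence generated by the axioms of
    Lie algebras; [free_lift] and [free_hom_ext] below are its universal
    property. *)

Section FreeLie.
Variables (K : fieldType) (m : nat).

Inductive lie_term :=
  | TVar of 'I_m
  | TZero
  | TOpp of lie_term
  | TAdd of lie_term & lie_term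
  | TScale of K & lie_term
  | TBr of lie_term & lie_term.

Inductive lie_cong : lie_term -> lie_term -> Prop :=
  | cong_refl s : lie_cong s s
  | cong_sym s t : lie_cong s t -> lie_cong t s
  | cong_trans t s r : lie_cong s t -> lie_cong t r -> lie_cong s r
  | cong_opp s s' : lie_cong s s' -> lie_cong (TOpp s) (TOpp s')
  | cong_add s s' t t' : lie_cong s s' -> lie_cong t t' ->
      lie_cong (TAdd s t) (TAdd s' t')
  | cong_scale a s s' : lie_cong s s' -> lie_cong (TScale a s) (TScale a s')
  | cong_br s s' t t' : lie_cong s s' -> lie_cong t t' ->
      lie_cong (TBr s t) (TBr s' t')
  | cong_addA s t r : lie_cong (TAdd s (TAdd t r)) (TAdd (TAdd s t) r)
  | cong_addC s t : lie_cong (TAdd s t) (TAdd t s)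
  | cong_add0 s : lie_cong (TAdd TZero s) s
  | cong_addN s : lie_cong (TAdd (TOpp s) s) TZero
  | cong_scaleA a b s : lie_cong (TScale a (TScale b s)) (TScale (a * b) s)
  | cong_scale1 s : lie_cong (TScale 1 s) s
  | cong_scaleDr a s t :
      lie_cong (TScale a (TAdd s t)) (TAdd (TScale a s) (TScale a t))
  | cong_scaleDl a b s :
      lie_cong (TScale (a + b) s) (TAdd (TScale a s) (TScale b s))
  | cong_brDl a s s' t : lie_cong (TBr (TAdd (TScale a s) s') t)
      (TAdd (TScale a (TBr s t)) (TBr s' t))
  | cong_brDr a s t t' : lie_cong (TBr s (TAdd (TScale a t) t'))
      (TAdd (TScale a (TBr s t)) (TBr s t'))
  | cong_brvv s : lie_cong (TBr s s) TZero
  | cong_jacobi s t r : lie_cong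
      (TAdd (TAdd (TBr s (TBr t r)) (TBr t (TBr r s))) (TBr r (TBr s t)))
      TZero.

Definition lie_congb : rel {classic lie_term} :=
  fun s t => `[< lie_cong s t >].

Lemma lie_congb_equiv : equiv_class_of lie_congb.
Proof.
split=> [s|s t|t s r]; first by apply/asboolP; exact: cong_refl.
  by apply/asboolP/asboolP; exact: cong_sym.
by move=> /asboolP st /asboolP tr; apply/asboolP; exact: cong_trans st tr.
Qed.

Canonical lie_cong_rel := EquivRelPack lie_congb_equiv.
Canonical lie_cong_encModRel := defaultEncModRel lie_congb.

Definition free_lie : Type := {eq_quot lie_congb}.
HB.instance Definition _ := Choice.on free_lie.

Definition free_pi (t : lie_term) : free_lie :=
  \pi_({eq_quot lie_congb}) (t : {classic lie_term}).
Definition free_repr (x : free_lie) : lie_term :=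
  @repr _ {eq_quot lie_congb} x.

Lemma free_reprK : cancel free_repr free_pi. Proof. exact: reprK. Qed.

Lemma free_piP s t : free_pi s = free_pi t <-> lie_cong s t.
Proof.
split=> [/eqP|st]; last apply/eqP.
  by rewrite /free_pi eqmodE => /asboolP.
by rewrite /free_pi eqmodE; apply/asboolP.
Qed.

Lemma free_pi_repr t : lie_cong (free_repr (free_pi t)) t.
Proof. by apply/free_piP; rewrite free_reprK. Qed.

Definition free_opp x := locked (free_pi (TOpp (free_repr x))).
Definition free_add x y := locked (free_pi (TAdd (free_repr x) (free_repr y))).
Definition free_scale a x := locked (free_pi (TScale a (free_repr x))).
Definition free_lieb x y := locked (free_pi (TBr (free_repr x) (free_repr y))).

Lemma free_piN t : free_pi (TOpp t) = free_opp (free_pi t).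
Proof. by rewrite /free_opp -lock; apply/free_piP; apply/cong_opp/cong_sym/free_pi_repr. Qed.
Lemma free_piD s t : free_pi (TAdd s t) = free_add (free_pi s) (free_pi t).
Proof. by rewrite /free_add -lock; apply/free_piP; apply/cong_add; apply/cong_sym/free_pi_repr. Qed.
Lemma free_piZ a t : free_pi (TScale a t) = free_scale a (free_pi t).
Proof. by rewrite /free_scale -lock; apply/free_piP; apply/cong_scale/cong_sym/free_pi_repr. Qed.
Lemma free_piB s t : free_pi (TBr s t) = free_lieb (free_pi s) (free_pi t).
Proof. by rewrite /free_lieb -lock; apply/free_piP; apply/cong_br; apply/cong_sym/free_pi_repr. Qed.

Let free_piE := (free_piN, free_piD, free_piZ, free_piB).

Lemma free_addA : associative free_add.
Proof.
move=> x y z; rewrite -[x]free_reprK -[y]free_reprK -[z]free_reprK -!free_piE.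
by apply/free_piP; constructor.
Qed.
Lemma free_addC : commutative free_add.
Proof.
move=> x y; rewrite -[x]free_reprK -[y]free_reprK -!free_piE.
by apply/free_piP; exact: cong_addC.
Qed.
Lemma free_add0 : left_id (free_pi TZero) free_add.
Proof.
by move=> x; rewrite -[x]free_reprK -!free_piE; apply/free_piP; constructor.
Qed.
Lemma free_addN : left_inverse (free_pi TZero) free_opp free_add.
Proof.
by move=> x; rewrite -[x]free_reprK -!free_piE; apply/free_piP; constructor.
Qed.

HB.instance Definition _ := GRing.isZmodule.Build free_lie
  free_addA free_addC free_add0 free_addN.

Lemma free_scaleA a b x : free_scale a (free_scale b x) = free_scale (a * b) x.
Proof.
by rewrite -[x]free_reprK -!free_piE; apply/free_piP; constructor.
Qed.
Lemma free_scale1 : left_id 1 free_scale.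
Proof.
by move=> x; rewrite -[x]free_reprK -!free_piE; apply/free_piP; constructor.
Qed.
Lemma free_scaleDr : right_distributive free_scale +%R.
Proof.
move=> a x y; rewrite -[x]free_reprK -[y]free_reprK.
rewrite -![_ + _]/(free_add _ _) -!free_piE.
by apply/free_piP; constructor.
Qed.
Lemma free_scaleDl x : {morph free_scale^~ x : a b / a + b}.
Proof.
move=> a b; rewrite -[x]free_reprK -[RHS]/(free_add _ _) -!free_piE.
by apply/free_piP; constructor.
Qed.

HB.instance Definition _ := GRing.Zmodule_isLmodule.Build K free_lie
  free_scaleA free_scale1 free_scaleDr free_scaleDl.

Lemma free_pi0 : free_pi TZero = 0. Proof. by []. Qed.
Lemma free_pi_opp t : free_pi (TOpp t) = - free_pi t.
Proof. exact: free_piN. Qed.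
Lemma free_pi_add s t : free_pi (TAdd s t) = free_pi s + free_pi t.
Proof. exact: free_piD. Qed.
Lemma free_pi_scale a t : free_pi (TScale a t) = a *: free_pi t.
Proof. exact: free_piZ. Qed.

Let free_piE' := (free_pi_opp, free_pi_add, free_pi_scale, free_piB).

Lemma free_lieb_linearl y : linear (free_lieb^~ y).
Proof.
move=> a x x' /=; rewrite -[x]free_reprK -[x']free_reprK -[y]free_reprK.
by rewrite -!free_piE'; apply/free_piP; constructor.
Qed.
Lemma free_lieb_linearr x : linear (free_lieb x).
Proof.
move=> a y y'; rewrite -[x]free_reprK -[y']free_reprK -[y]free_reprK.
by rewrite -!free_piE'; apply/free_piP; constructor.
Qed.
Lemma free_liebvv x : free_lieb x x = 0.
Proof.
by rewrite -[x]free_reprK -free_pi0 -!free_piE'; apply/free_piP; constructor.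
Qed.
Lemma free_lieb_jacobi x y z :
  free_lieb x (free_lieb y z) + free_lieb y (free_lieb z x) +
  free_lieb z (free_lieb x y) = 0.
Proof.
rewrite -[x]free_reprK -[y]free_reprK -[z]free_reprK -free_pi0 -!free_piE'.
by apply/free_piP; constructor.
Qed.

HB.instance Definition _ := Lmodule_isLie.Build K free_lie
  free_lieb_linearl free_lieb_linearr free_liebvv free_lieb_jacobi.

Lemma free_pi_br s t : free_pi (TBr s t) = [lie free_pi s, free_pi t].
Proof. exact: free_piB. Qed.

Definition free_gen (i : 'I_m) : free_lie := free_pi (TVar i).

Section Lift.
Variables (M : lieAlgType K) (f : 'I_m -> M).

Fixpoint term_eval (t : lie_term) : M :=
  match t with
  | TVar i => f i
  | TZero => 0
  | TOpp s => - term_eval s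
  | TAdd s r => term_eval s + term_eval r
  | TScale a s => a *: term_eval s
  | TBr s r => [lie term_eval s, term_eval r]
  end.

Lemma term_eval_cong s t : lie_cong s t -> term_eval s = term_eval t.
Proof.
elim=> {s t} //=.
- by move=> t s r _ -> _ ->.
- by move=> s s' _ ->.
- by move=> s s' t t' _ -> _ ->.
- by move=> a s s' _ ->.
- by move=> s s' t t' _ -> _ ->.
- by move=> *; rewrite addrA.
- by move=> *; rewrite addrC.
- by move=> *; rewrite add0r.
- by move=> *; rewrite addNr.
- by move=> *; rewrite scalerA.
- by move=> *; rewrite scale1r.
- by move=> *; rewrite scalerDr.
- by move=> *; rewrite scalerDl.
- by move=> *; rewrite liebDl liebZl.
- by move=> *; rewrite liebDr liebZr.
- by move=> *; rewrite liebvv.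
- by move=> *; rewrite lieb_jacobi.
Qed.

Definition free_lift (x : free_lie) : M := term_eval (free_repr x).

Lemma free_liftE t : free_lift (free_pi t) = term_eval t.
Proof. exact/term_eval_cong/free_pi_repr. Qed.

Lemma free_lift_hom : lie_hom free_lift.
Proof.
split=> [a x y|x y]; rewrite -[x]free_reprK -[y]free_reprK.
  by rewrite -!(free_pi_scale, free_pi_add) !free_liftE.
by rewrite -free_pi_br !free_liftE.
Qed.

Lemma free_lift_gen i : free_lift (free_gen i) = f i.
Proof. exact: free_liftE. Qed.

End Lift.

Lemma free_hom_ext (M : lieAlgType K) (f g : free_lie -> M) :
  lie_hom f -> lie_hom g -> (forall i, f (free_gen i) = g (free_gen i)) ->
  f =1 g.
Proof.
move=> fh gh fg x; rewrite -[x]free_reprK.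
elim: (free_repr x) => [i||t IHt|s IHs t IHt|a t IHt|s IHs t IHt].
- exact: fg.
- by rewrite free_pi0 !lie_hom0.
- by rewrite free_pi_opp -scaleN1r !lie_homZ // IHt.
- by rewrite free_pi_add !lie_homD // IHs IHt.
- by rewrite free_pi_scale !lie_homZ // IHt.
- by rewrite free_pi_br fh.2 gh.2 IHs IHt.
Qed.

End FreeLie.

Definition free_mn (K : fieldType) (m c : nat) : Type :=
  lie_quot (metab_nilp (free_lie K m) c).

HB.instance Definition _ K m c := LieAlgebra.on (free_mn K m c).

Definition mn_gen (K : fieldType) (m c : nat) (i : 'I_m) : free_mn K m c :=
  quot_pi (metab_nilp (free_lie K m) c) (free_gen K i).

Lemma mn_hom_ext (K : fieldType) (m c : nat) (M : lieAlgType K)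
    (f g : free_mn K m c -> M) :
  lie_hom f -> lie_hom g ->
  (forall i, f (mn_gen K c i) = g (mn_gen K c i)) -> f =1 g.
Proof.
move=> fh gh fg x; rewrite -[x]quot_reprK.
have ph := quot_pi_hom (metab_nilp (free_lie K m) c).
exact: (free_hom_ext (lie_hom_comp fh ph) (lie_hom_comp gh ph) fg).
Qed.

Section Aut.
Variables (K : fieldType) (L : lieAlgType K).

Record lie_aut := LieAut {
  aut_fun :> L -> L;
  aut_hom : lie_hom aut_fun;
  aut_bij : bijective aut_fun
}.

HB.instance Definition _ := gen_eqMixin lie_aut.
HB.instance Definition _ := gen_choiceMixin lie_aut.

Lemma lie_aut_ext (f g : lie_aut) : f =1 g -> f = g.
Proof.
move: f g => [f fh fb] [g gh gb] /= /funext fg; rewrite fg in fh fb *.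
by congr LieAut; exact: Prop_irrelevance.
Qed.

Lemma aut_one_hom : lie_hom (idfun : L -> L). Proof. by []. Qed.
Lemma aut_one_bij : bijective (idfun : L -> L). Proof. by exists idfun. Qed.

Definition aut_one := LieAut aut_one_hom aut_one_bij.
Definition aut_mul (f g : lie_aut) :=
  LieAut (lie_hom_comp (aut_hom f) (aut_hom g))
         (bij_comp (aut_bij f) (aut_bij g)).

Lemma aut_inv_subproof (f : lie_aut) :
  exists g : lie_aut, cancel f g /\ cancel g f.
Proof.
have [[fl fb] [g fK gK]] := (aut_hom f, aut_bij f).
have gh : lie_hom g.
  split=> [a u v|u v]; apply: (can_inj fK); rewrite gK ?fl ?fb !gK //.
by have gb : bijective g; [exists f | exists (LieAut gh gb)].
Qed.

Definition aut_inv (f : lie_aut) : lie_aut := projT1 (cid (aut_inv_subproof f)).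

Lemma aut_mulA : associative aut_mul.
Proof. by move=> f g h; apply: lie_aut_ext. Qed.
Lemma aut_mul1 : left_id aut_one aut_mul.
Proof. by move=> f; apply: lie_aut_ext. Qed.
Lemma aut_mulr1 : right_id aut_one aut_mul.
Proof. by move=> f; apply: lie_aut_ext. Qed.
Lemma aut_mulV : left_inverse aut_one aut_inv aut_mul.
Proof.
by move=> f; apply: lie_aut_ext => u; rewrite /aut_inv /=; case: cid => g [].
Qed.
Lemma aut_mulrV : right_inverse aut_one aut_inv aut_mul.
Proof.
by move=> f; apply: lie_aut_ext => u; rewrite /aut_inv /=; case: cid => g [].
Qed.

HB.instance Definition _ := isGroup.Build lie_aut
  aut_mulA aut_mul1 aut_mulr1 aut_mulV aut_mulrV.

Definition normal_aut : set lie_aut :=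
  [set phi | forall I : set L, lie_ideal I -> phi @` I = I].

(** [phi] is the locally finite sum [exp (ad v) = \sum_k (ad v)^k / k!] *)
Definition is_exp_ad (v : L) (phi : L -> L) : Prop :=
  forall u, exists N, forall n, (N <= n)%N ->
    phi u = \sum_(k < n) (k`!%:R)^-1 *: iter k (ad v) u.

Definition inner_aut : set lie_aut :=
  [set phi | exists v, is_exp_ad v phi].

End Aut.

Arguments normal_aut {K} L.
Arguments inner_aut {K} L.

(** The operators are applied in the order [ad x_1], ..., [ad x_m]; the order
    is irrelevant on the derived algebra of a metabelian Lie algebra. *)
Definition ad_monomial (K : fieldType) (L : lieAlgType K) (m : nat)
    (x : 'I_m -> L) (e : 'X_{1..m}) (u : L) : L :=
  foldl (fun w i => iter (e i) (ad (x i)) w) u (enum 'I_m).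

Definition ad_poly (K : fieldType) (L : lieAlgType K) (m : nat)
    (x : 'I_m -> L) (f : {mpoly K[m]}) (u : L) : L :=
  \sum_(e <- msupp f) f@_e *: ad_monomial x e u.

Definition ginner_aut (K : fieldType) (m c : nat) :
    set (lie_aut (free_mn K m c)) :=
  let x := mn_gen K c in
  [set phi | exists f : 'I_m -> {mpoly K[m]},
     forall i, phi (x i) = x i + \sum_(j < m) ad_poly x (f j) [lie x i, x j]].

Arguments ginner_aut : clear implicits.

Definition is_subgroup (G : groupType) (A : set G) : Prop :=
  [/\ A 1%g, forall g h, A g -> A h -> A (g * h)%g
    & forall g, A g -> A g^-1%g].

Definition group_iso (G H : groupType) (A : set G) (B : set H) : Prop :=
  [/\ is_subgroup A, is_subgroup B &
    exists f : G -> H, set_bij A B f /\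
      forall g h, A g -> A h -> f (g * h)%g = (f g * f h)%g].

Section SemiDirect.
Variables (A G : groupType).

(** The carrier of [A |>< G], where [a : A] acts on the normal factor [G] by
    conjugation by [s a]; [SdPair s a g] stands for the product [a g]. *)
Record sdpair (s : {multiplicative A -> G}) := SdPair { sd1 : A; sd2 : G }.

Variable s : {multiplicative A -> G}.

HB.instance Definition _ := gen_eqMixin (sdpair s).
HB.instance Definition _ := gen_choiceMixin (sdpair s).

Definition sd_one : sdpair s := SdPair s 1%g 1%g.
Definition sd_mul (p q : sdpair s) : sdpair s :=
  SdPair s (sd1 p * sd1 q)%g (sd2 p ^ s (sd1 q) * sd2 q)%g.
Definition sd_inv (p : sdpair s) : sdpair s :=
  SdPair s (sd1 p)^-1%g ((sd2 p)^-1 ^ (s (sd1 p))^-1)%g.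

Lemma sd_act1 : s 1%g = 1%g.
Proof. by apply: (mulgI (s 1%g)); rewrite -gmulfM !mulg1. Qed.
Lemma sd_actV a : s a^-1%g = ((s a)^-1)%g.
Proof. by apply: (mulgI (s a)); rewrite -gmulfM !mulgV sd_act1. Qed.

Lemma sd_mulA : associative sd_mul.
Proof.
move=> p q r; rewrite /sd_mul /= mulgA; congr SdPair.
by rewrite gmulfM conjMg conjgM mulgA.
Qed.
Lemma sd_mul1 : left_id sd_one sd_mul.
Proof. by case=> a g; rewrite /sd_mul /= conj1g !mul1g. Qed.
Lemma sd_mulr1 : right_id sd_one sd_mul.
Proof. by case=> a g; rewrite /sd_mul /= sd_act1 conjg1 !mulg1. Qed.
Lemma sd_mulV : left_inverse sd_one sd_inv sd_mul.
Proof.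
by case=> a g; rewrite /sd_mul /= -conjgM !mulVg conjg1 mulVg.
Qed.
Lemma sd_mulrV : right_inverse sd_one sd_inv sd_mul.
Proof.
by case=> a g; rewrite /sd_mul /= sd_actV -conjMg !mulgV conj1g.
Qed.

HB.instance Definition _ := isGroup.Build (sdpair s)
  sd_mulA sd_mul1 sd_mulr1 sd_mulV sd_mulrV.

(** [A |>< H] for [H] a subset of [G] (a subgroup stable under the action) *)
Definition sdprod (H : set G) : set (sdpair s) := [set p | H (sd2 p)].

End SemiDirect.

Arguments sdprod {A G} s H.

Section Units.
Variable K : fieldType.

Record Kunit := MkKunit { uval : K; _ : uval \is a GRing.unit }.
HB.instance Definition _ := [isSub for uval].
HB.instance Definition _ := [Choice of Kunit by <:].

Implicit Types a b : Kunit.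

Lemma uvalP a : uval a \is a GRing.unit. Proof. exact: valP a. Qed.

Definition unit_one := MkKunit (@unitr1 K).
Lemma unit_mul_subproof a b : uval a * uval b \is a GRing.unit.
Proof. by rewrite unitrM !uvalP. Qed.
Definition unit_mul a b := MkKunit (unit_mul_subproof a b).
Lemma unit_inv_subproof a : (uval a)^-1 \is a GRing.unit.
Proof. by rewrite unitrV uvalP. Qed.
Definition unit_inv a := MkKunit (unit_inv_subproof a).

Lemma unit_mulA : associative unit_mul.
Proof. by move=> a b c; apply/val_inj/mulrA. Qed.
Lemma unit_mul1 : left_id unit_one unit_mul.
Proof. by move=> a; apply/val_inj/mul1r. Qed.
Lemma unit_mulr1 : right_id unit_one unit_mul.
Proof. by move=> a; apply/val_inj/mulr1. Qed.
Lemma unit_mulV : left_inverse unit_one unit_inv unit_mul.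
Proof. by move=> a; apply/val_inj/mulVr/uvalP. Qed.
Lemma unit_mulrV : right_inverse unit_one unit_inv unit_mul.
Proof. by move=> a; apply/val_inj/mulrV/uvalP. Qed.

HB.instance Definition _ := isGroup.Build Kunit
  unit_mulA unit_mul1 unit_mulr1 unit_mulV unit_mulrV.

End Units.

Section Scaling.
Variables (K : fieldType) (m c : nat).
Let x := mn_gen K c : 'I_m -> _.

Lemma mn_endo_exists (a : K) : exists2 g : free_mn K m c -> free_mn K m c,
  lie_hom g & forall i, g (x i) = a *: x i.
Proof.
pose N := metab_nilp (free_lie K m) c.
pose f := free_lift (fun i : 'I_m => a *: free_gen K i).
have fh : lie_hom f := free_lift_hom _.
have pfh := lie_hom_comp (quot_pi_hom N) fh.
have [u Nu|g gh gE] := quot_lift_hom pfh (I := N).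
  rewrite /= -(lie_hom0 (quot_pi_hom N)); apply/quot_piP; rewrite subr0.
  exact: metab_nilp_hom.
by exists g => // i; rewrite gE /= /f free_lift_gen (lie_homZ (quot_pi_hom N)).
Qed.

Lemma scaling_exists (a : Kunit K) :
  exists phi : lie_aut (free_mn K m c), forall i, phi (x i) = uval a *: x i.
Proof.
have [f fh fE] := mn_endo_exists (uval a).
have [g gh gE] := mn_endo_exists (uval a)^-1.
have fb : bijective f; last by exists (LieAut fh fb).
have idh : lie_hom (idfun : free_mn K m c -> _) by [].
exists g; [apply: (mn_hom_ext (lie_hom_comp gh fh) idh)
          |apply: (mn_hom_ext (lie_hom_comp fh gh) idh)] => i /=.
  by rewrite fE (lie_homZ gh) gE scalerA mulrV ?scale1r // uvalP.
by rewrite gE (lie_homZ fh) fE scalerA mulVr ?scale1r // uvalP.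
Qed.

(** The automorphism [x_i |-> a x_i]; see [scalingE] *)
Definition scaling (a : Kunit K) : lie_aut (free_mn K m c) :=
  projT1 (cid (scaling_exists a)).

Lemma scalingE a i : scaling a (x i) = uval a *: x i.
Proof. by rewrite /scaling; case: cid. Qed.

Lemma scalingM : {morph scaling : a b / (a * b)%g}.
Proof.
move=> a b; apply/lie_aut_ext/mn_hom_ext; try exact: aut_hom.
move=> i; rewrite -/x scalingE /= scalingE (lie_homZ (aut_hom _)) scalingE.
by rewrite scalerA [uval b * _]mulrC.
Qed.

HB.instance Definition _ :=
  isMultiplicative.Build (Kunit K) (lie_aut (free_mn K m c)) scaling scalingM.

End Scaling.

Arguments scaling : clear implicits.

(* Main.v *)
Require Import Defs.
From HB Require Import structures.
From mathcomp Require Import all_boot all_order all_algebra.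
From mathcomp Require Import boolp classical_sets functions.
From mathcomp Require Import ssrcomplements mpoly ring.

(** Write [L = L_(m,c)] and [L'] for its derived algebra, which is
    [lcs 2].  The operators [ad x_i] commute on [L'], so [L'] is a module over
    [K[t_1, ..., t_m]], where [t_i] acts as [ad x_i]; [ad_poly x f] is the
    action of [f].

    Every subspace containing [L'] is an ideal.  A normal automorphism
    therefore preserves every line of [L / L'], and since the [x_i] are
    independent modulo [L'] it acts on [L / L'] as a scalar [a], which is not
    0 ([normal_aut_scalar]).  Call an automorphism IA if this scalar is 1.  If
    all the scalings [x_i |-> a x_i] are normal, the group of normal
    automorphisms is the semidirect product of [K^*] and its subgroup of normal
    IA automorphisms ([normal_aut_sdprod]).  Three things remain.

    - The normal IA automorphisms are the generalized inner ones.  If [phi] is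
    given by [x_i |-> x_i + \sum_j [x_i, x_j] f_j], then
    [delta u = \sum_j [u, x_j] f_j] is a derivation of [L] with values in the
    abelian ideal [L'], so [1 + delta] is an endomorphism and equals [phi].
    It preserves every ideal because [delta] does, and it is onto on every
    ideal because [delta] moves down the lower central series
    ([ginner_normal_ia]).  Conversely [L'] is a cyclic module for [m = 2], and
    every IA automorphism is then generalized inner ([ia_ginner_two]).  For
    [m >= 3], normality on the ideal of [x_i] gives
    [phi x_i = x_i + \sum_j [x_i, x_j] f_ij], and normality on the ideals of
    all the [x_i + b x_k] forces [f_ij = f_kj] up to terms which kill [x_i, x_j]
    ([normal_ia_coef_indep]).

    - Scalings are normal when [c = 1], and when [m =
      2] and [c <= 3]: there each
    element of an ideal is an eigenvector of the scalings up to a term of the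
    lower central series that the ideal contains ([scaling_normal_two]).

    - In the other cases the scalar [a] is 1, because some ideal mixes two
    degrees: one containing [x_1 + [x_2, x_3]] gives [a = a^2]
    ([scalar_one_three]), and for [m = 2], [c >= 4] one containing
    [[z, x_1] + [[z, x_2], x_2]], where [z = [x_1, x_2]], gives [a^3 = a^4]
    ([scalar_one_two]).

    The statements that some element is not 0 are all seen in one family of
    finite dimensional metabelian algebras: pairs of polynomials in one
    variable [T], with [[(p, q), (p', q')] = (T (p q' - p' q), 0)], modulo
    [T^d] in the first component. *)

Set Implicit Arguments.
Unset Strict Implicit.
Unset Printing Implicit Defensive.

Import GRing.Theory.
Local Open Scope classical_set_scope.
Local Open Scope ring_scope.

(** * Subspaces, ideals and generators of Lie algebras *)

Section Subspaces.
Variables (K : fieldType) (L : lieAlgType K).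
Implicit Types (S I J : set L) (u v w : L).

Lemma subspaceZ S a u : subspace S -> S u -> S (a *: u).
Proof. by move=> [S0 Sl] Su; rewrite -[_ *: _]addr0; exact: Sl. Qed.

Lemma subspaceD S u v : subspace S -> S u -> S v -> S (u + v).
Proof. by move=> [S0 Sl] Su Sv; rewrite -[u]scale1r; exact: Sl. Qed.

Lemma subspaceN S u : subspace S -> S u -> S (- u).
Proof. by move=> Ss Su; rewrite -scaleN1r; exact: subspaceZ. Qed.

Lemma subspaceB S u v : subspace S -> S u -> S v -> S (u - v).
Proof. by move=> Ss Su Sv; apply: subspaceD => //; exact: subspaceN. Qed.

Lemma subspace_sum S (T : Type) (r : seq T) (P : pred T) (F : T -> L) :
  subspace S -> (forall i, P i -> S (F i)) -> S (\sum_(i <- r | P i) F i).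
Proof.
by move=> Ss SF; apply: big_ind => //; [case: Ss | move=> *; exact: subspaceD].
Qed.

Lemma liebBl u v w : [lie u - v, w] = [lie u, w] - [lie v, w].
Proof. by rewrite liebDl liebNl. Qed.

Lemma liebBr u v w : [lie u, v - w] = [lie u, v] - [lie u, w].
Proof. by rewrite liebDr liebNr. Qed.

Lemma lieb_leibnizr u v w :
  [lie u, [lie v, w]] = [lie [lie u, v], w] - [lie [lie u, w], v].
Proof. by rewrite (lieb_leibniz u v w) addrC addKr. Qed.

Lemma lieb_suml (T : Type) (r : seq T) (P : pred T) (F : T -> L) v :
  [lie \sum_(i <- r | P i) F i, v] = \sum_(i <- r | P i) [lie F i, v].
Proof. exact: (big_morph (lieb^~ v) (fun u w => liebDl u w v) (lieb0l v)). Qed.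

Lemma lieb_sumr (T : Type) (r : seq T) (P : pred T) (F : T -> L) u :
  [lie u, \sum_(i <- r | P i) F i] = \sum_(i <- r | P i) [lie u, F i].
Proof. exact: (big_morph (lieb u) (liebDr u) (lieb0r u)). Qed.

Lemma sub_bracket_space (A B S : set L) :
  subspace S -> (forall u v, A u -> B v -> S [lie u, v]) ->
  bracket_space A B `<=` S.
Proof.
by move=> Ss AB; apply: smallest_sub => // _ [u Au [v Bv <-]]; exact: AB.
Qed.

Lemma lieb_bracket_space (A B : set L) u v :
  A u -> B v -> bracket_space A B [lie u, v].
Proof. by move=> Au Bv; apply: sub_gen_smallest; exists u => //; exists v. Qed.

Lemma lcs_subspace k : subspace (@lcs _ L k).
Proof. by case: (lie_ideal_lcs L k). Qed.

Lemma lcs0 k : @lcs _ L k 0.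
Proof. by case: (lcs_subspace k). Qed.

Lemma lcsD k u v : @lcs _ L k u -> @lcs _ L k v -> @lcs _ L k (u + v).
Proof. exact: subspaceD (lcs_subspace k). Qed.

Lemma lcsB k u v : @lcs _ L k u -> @lcs _ L k v -> @lcs _ L k (u - v).
Proof. exact: subspaceB (lcs_subspace k). Qed.

Lemma lcsN k u : @lcs _ L k u -> @lcs _ L k (- u).
Proof. exact: subspaceN (lcs_subspace k). Qed.

Lemma lcsZ k a u : @lcs _ L k u -> @lcs _ L k (a *: u).
Proof. exact: subspaceZ (lcs_subspace k). Qed.

Lemma lcsS_bracket k u v : @lcs _ L k.+1 u -> @lcs _ L k.+2 [lie u, v].
Proof. by move=> Lu; exact: lieb_bracket_space. Qed.

Lemma lcs2_bracket u v : @lcs _ L 2 [lie u, v].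
Proof. exact: lieb_bracket_space. Qed.

Lemma lcsS_sub k : @lcs _ L k.+1 `<=` @lcs _ L k.
Proof.
case: k => // k; elim: k => // k IHk; apply: sub_bracket_space => [|u v /IHk].
  exact: lcs_subspace.
by move=> Lu _; exact: lcsS_bracket.
Qed.

Lemma lcs_sub k l : (k <= l)%N -> @lcs _ L l `<=` @lcs _ L k.
Proof.
by move=> /subnK <-; elim: (l - k)%N => // n IHn u /lcsS_sub; exact: IHn.
Qed.

End Subspaces.

Arguments subspace_sum {K L S T r P F}.

(** Together with [bracket_space_hom], this computes the ideal
    [L'' + L^(c+1)] of a homomorphic image, and so shows that it vanishes in
    the free metabelian nilpotent algebra. *)
Lemma bracket_space_surj (K : fieldType) (L M : lieAlgType K) (f : L -> M)
    (A B : set L) (A' B' : set M) :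
  lie_hom f -> A' `<=` f @` A -> B' `<=` f @` B ->
  bracket_space A' B' `<=` f @` bracket_space A B.
Proof.
move=> fh sA sB; have sAB := subspace_smallest
  [set [lie u, v] | u in A & v in B].
apply: sub_bracket_space => [|_ _ /sA[u Au <-] /sB[v Bv <-]].
  split=> [|a _ _ [u Iu <-] [v Iv <-]].
    by exists 0; [case: sAB | exact: lie_hom0].
  by exists (a *: u + v); [exact: sAB.2 | exact: fh.1].
by exists [lie u, v]; [exact: lieb_bracket_space | exact: fh.2].
Qed.

Lemma metab_nilp_surj (K : fieldType) (L M : lieAlgType K) (f : L -> M) c :
  lie_hom f -> (forall v, exists u, f u = v) ->
  metab_nilp M c `<=` f @` metab_nilp L c.
Proof.
move=> fh fsurj.
have fT : [set: M] `<=` f @` [set: L] by move=> v _; have [u] := fsurj v;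
  exists u.
have flcs k : @lcs _ M k.+1 `<=` f @` @lcs _ L k.+1.
  by elim: k => // k IHk; exact: bracket_space_surj.
have fder : derived (derived [set: M]) `<=` f @` derived (derived [set: L]).
  by apply: bracket_space_surj => //; exact: bracket_space_surj.
move=> _ [_ /fder[v Lv <-] [_ /flcs[w Lw <-] <-]].
by exists (v + w); [exists v => //; exists w | exact: lie_homD].
Qed.

Lemma lie_hom_lcs (K : fieldType) (L M : lieAlgType K) (f : L -> M) k u :
  lie_hom f -> @lcs _ L k u -> @lcs _ M k (f u).
Proof.
move=> fh; case: k => // k; elim: k u => // k IHk u.
exact: bracket_space_hom.
Qed.

Lemma lie_hom_sum (K : fieldType) (L M : lieAlgType K) (f : L -> M)
    (T : Type) (r : seq T) (P : pred T) (F : T -> L) :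
  lie_hom f ->
  f (\sum_(i <- r | P i) F i) = \sum_(i <- r | P i) f (F i).
Proof. by move=> fh; exact: (big_morph f (lie_homD fh) (lie_hom0 fh)). Qed.

Lemma lie_ideal_ker (K : fieldType) (L M : lieAlgType K) (f : L -> M) :
  lie_hom f -> lie_ideal [set u | f u = 0].
Proof.
move=> fh; split; [split=> [|a u v /= fu fv]|move=> u v /= fu].
- exact: lie_hom0.
- by rewrite fh.1 fu fv scaler0 addr0.
- by rewrite fh.2 fu lieb0l.
Qed.

Section Generators.
Variables (K : fieldType) (L : lieAlgType K) (m : nat) (x : 'I_m -> L).
Implicit Types (S I J : set L) (u v w : L).

(** Generation is encoded as induction over the Lie subalgebras containing
    the [x i]. *)
Definition lie_generates : Prop := forall S : set L, subspace S ->
  (forall u v, S u -> S v -> S [lie u, v]) -> (forall i, S (x i)) ->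
  forall u, S u.

Hypothesis xgen : lie_generates.

(** The elements [v] with [[lie S, v]] in [S] form a subalgebra, by the
    Jacobi identity. *)
Lemma lie_ideal_gen S :
  subspace S -> (forall i u, S u -> S [lie u, x i]) -> lie_ideal S.
Proof.
move=> Ss Sx; split=> // u v; move: v u.
apply: xgen => [|v w Sv Sw u Su|i u]; last exact: Sx.
  split=> [u _|a v w Sv Sw u Su]; first by rewrite lieb0r; case: Ss.
  by rewrite liebDr liebZr; apply: Ss.2; [exact: Sv | exact: Sw].
by rewrite lieb_leibnizr; apply: subspaceB => //; [apply/Sw/Sv | apply/Sv/Sw].
Qed.

(** The elements [v] with [[lie u, v]] in [I] form a subalgebra, since [I] is
    an ideal. *)
Lemma bracket_gen_sub I u :
  lie_ideal I -> (forall i, I [lie u, x i]) -> forall v, I [lie u, v].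
Proof.
move=> [Is Ii] Iu; apply: xgen => // [|v w Iv Iw].
  split=> [|a v w Iv Iw]; first by rewrite lieb0r; case: Is.
  by rewrite liebDr liebZr; exact: Is.2.
by rewrite lieb_leibnizr; apply: subspaceB => //; exact: Ii.
Qed.

Lemma lie_ideal_bracket_in I :
  lie_ideal I -> lie_ideal [set u | forall v, I [lie u, v]].
Proof.
move=> [Is Ii]; split; [split=> [v|a u u' Iu Iu' v]|move=> u v Iu w].
- by rewrite lieb0l; case: Is.
- by rewrite liebDl liebZl; exact: Is.2.
- by apply: (Ii); exact: Iu.
Qed.

Lemma lcs2_sub I :
  lie_ideal I -> (forall i j, I [lie x i, x j]) -> @lcs _ L 2 `<=` I.
Proof.
move=> Ii Ix; apply: sub_bracket_space => [|u v _ _]; first by case: Ii.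
move: u v; apply: xgen => [|u v Su Sv w|i]; last exact: bracket_gen_sub.
  by case: (lie_ideal_bracket_in Ii).
by have [_ /(_ _ v Su w)] := lie_ideal_bracket_in Ii.
Qed.

Lemma gen_mod_lcs2 u :
  exists b : 'I_m -> K, @lcs _ L 2 (u - \sum_i b i *: x i).
Proof.
have Ls := @lcs_subspace K L 2.
move: u; apply: xgen => [|u v _ _|i].
- split=> [|a u v [b Lu] [c Lv]].
    exists (fun=> 0); rewrite big1 ?subr0; first by case: Ls.
    by move=> i _; rewrite scale0r.
  exists (fun i => a * b i + c i).
  rewrite (eq_bigr (fun i => a *: (b i *: x i) + c i *: x i)); last first.
    by move=> i _; rewrite scalerDl scalerA.
  rewrite big_split /= -scaler_sumr opprD addrACA -scalerBr.
  exact: Ls.2.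
- exists (fun=> 0); rewrite big1 ?subr0; first exact: lcs2_bracket.
  by move=> i _; rewrite scale0r.
- exists (fun j => (j == i)%:R); rewrite (bigD1 i) //= eqxx scale1r big1.
    by rewrite addr0 subrr; case: Ls.
  by move=> j /negPf ->; rewrite scale0r.
Qed.

End Generators.

Section FreeMN.
Variables (K : fieldType) (m c : nat).
Local Notation L := (free_mn K m c).
Local Notation x := (@mn_gen K m c).

Lemma mn_gen_generates : lie_generates x.
Proof.
move=> S Ss Sb Sx u; rewrite -[u]quot_reprK.
set p := quot_pi _; have ph : lie_hom p := quot_pi_hom _.
move: (quot_repr u) => v; rewrite -[v]free_reprK.
elim: (free_repr v) => [i||t IHt|s IHs t IHt|a t IHt|s IHs t IHt].
- exact: Sx.
- by rewrite free_pi0 (lie_hom0 ph); case: Ss.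
- by rewrite free_pi_opp -scaleN1r (lie_homZ ph); exact: subspaceZ.
- by rewrite free_pi_add (lie_homD ph); exact: subspaceD.
- by rewrite free_pi_scale (lie_homZ ph); exact: subspaceZ.
- by rewrite free_pi_br ph.2; exact: Sb.
Qed.

Lemma mn_metab_nilp0 (u : L) : metab_nilp L c u -> u = 0.
Proof.
set F := free_lie K m; pose p : F -> L := quot_pi (metab_nilp F c).
have ph : lie_hom p := quot_pi_hom _.
have psurj (v : L) : exists w, p w = v.
  by exists (quot_repr v); exact: quot_reprK.
move=> /(metab_nilp_surj ph psurj)[w Fw <-].
by rewrite -(lie_hom0 ph); apply/quot_piP; rewrite subr0.
Qed.

Lemma mn_lcs_eq0 k (u : L) : (c < k)%N -> @lcs _ L k u -> u = 0.
Proof.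
move=> ck /(lcs_sub ck) Lu; apply: mn_metab_nilp0.
exists 0; last by exists u => //; rewrite add0r.
by case: (subspace_smallest [set [lie u, v] | u in derived [set: L]
  & v in derived [set: L]]).
Qed.

Lemma mn_metabelian (u v : L) : @lcs _ L 2 u -> @lcs _ L 2 v -> [lie u, v] = 0.
Proof.
move=> Lu Lv; apply: mn_metab_nilp0; exists [lie u, v].
  exact: lieb_bracket_space.
by exists 0; rewrite ?addr0 //; case: (@lcs_subspace K L c.+1).
Qed.

Lemma mn_hom_exists (M : lieAlgType K) (y : 'I_m -> M) :
  (forall u, metab_nilp M c u -> u = 0) ->
  exists2 f : L -> M, lie_hom f & forall i, f (x i) = y i.
Proof.
move=> M0; have fh := free_lift_hom y.
have [u Nu|g gh gE] := quot_lift_hom fh (I := metab_nilp (free_lie K m) c).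
  by apply: M0; exact: metab_nilp_hom.
by exists g => // i; rewrite gE free_lift_gen.
Qed.

End FreeMN.

(** * Polynomials in the operators ad x_i *)

Definition metabelian (K : fieldType) (L : lieAlgType K) : Prop :=
  forall u v : L, @lcs _ L 2 u -> @lcs _ L 2 v -> [lie u, v] = 0.

Section AdMonomial.
Variables (K : fieldType) (m : nat).
Implicit Types (e : 'X_{1..m}).

(** A logical-relation principle: invariance under the operators, commutation
    with another operator and naturality along homomorphisms are all
    instances. *)
Lemma ad_monomial_rel (L M : lieAlgType K) (x : 'I_m -> L) (y : 'I_m -> M)
    (R : L -> M -> Prop) e u v :
  (forall i u v, R u v -> R [lie u, x i] [lie v, y i]) ->
  R u v -> R (ad_monomial x e u) (ad_monomial y e v).
Proof.
move=> RS; rewrite /ad_monomial; elim: (enum _) u v => //= i s IHs u v Ruv.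
by apply: IHs; elim: (e i) => //= n IHn; exact: RS.
Qed.

Variables (L : lieAlgType K) (x : 'I_m -> L).
Implicit Types (u v w : L) (f g : {mpoly K[m]}).

Lemma ad_monomial_sub (S : set L) e u :
  (forall i u, S u -> S [lie u, x i]) -> S u -> S (ad_monomial x e u).
Proof.
move=> Sx Su; apply: (@ad_monomial_rel _ _ _ x (fun u _ => S u) e u u) => //.
by move=> i v _; exact: Sx.
Qed.

Lemma ad_monomial_linear e : linear (ad_monomial x e).
Proof.
move=> a u v; rewrite /ad_monomial.
elim: (enum _) u v => //= i s IHs u v; rewrite -IHs; congr foldl.
by elim: (e i) => //= n ->; rewrite /ad liebDl liebZl.
Qed.

Lemma ad_monomial0 u : ad_monomial x 0%MM u = u.
Proof.
rewrite /ad_monomial; elim: (enum _) u => //= i s IHs u.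
by rewrite mnm0E.
Qed.

(** A range of monomials that depends only on a degree bound is what allows
    two polynomials with different supports to be added. *)
Lemma ad_poly_bound k f u : (msize f <= k)%N ->
  ad_poly x f u = \sum_(e : 'X_{1..m < k}) f@_e *: ad_monomial x e u.
Proof.
move=> lt_pk; pose I : subFinType _ := 'X_{1..m < k}.
rewrite /ad_poly (big_mksub I) //=; first last.
  by move=> e /msize_mdeg_lt /leq_trans; apply.
  by rewrite msupp_uniq.
by rewrite big_rmcond //= => i; move/memN_msupp_eq0 ->; rewrite scale0r.
Qed.

Lemma ad_poly_linearl a f g u :
  ad_poly x (a *: f + g) u = a *: ad_poly x f u + ad_poly x g u.
Proof.
pose k := maxn (msize (a *: f + g)) (maxn (msize f) (msize g)).
rewrite !(@ad_poly_bound k) ?leq_max ?leqnn ?orbT //.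
rewrite scaler_sumr -big_split /=; apply: eq_bigr => e _.
by rewrite mcoeffD mcoeffZ scalerDl scalerA.
Qed.

Lemma ad_poly0l u : ad_poly x 0 u = 0.
Proof. by rewrite /ad_poly msupp0 big_nil. Qed.

Lemma ad_polyDl f g u : ad_poly x (f + g) u = ad_poly x f u + ad_poly x g u.
Proof. by have := ad_poly_linearl 1 f g u; rewrite !scale1r. Qed.

Lemma ad_polyZl a f u : ad_poly x (a *: f) u = a *: ad_poly x f u.
Proof.
by have := ad_poly_linearl a f 0 u; rewrite ad_poly0l !addr0.
Qed.

Lemma ad_polyBl f g u : ad_poly x (f - g) u = ad_poly x f u - ad_poly x g u.
Proof. by rewrite -scaleN1r ad_polyDl ad_polyZl scaleN1r. Qed.

Lemma ad_polyNl f u : ad_poly x (- f) u = - ad_poly x f u.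
Proof. by rewrite -scaleN1r ad_polyZl scaleN1r. Qed.

Lemma ad_poly_suml (T : Type) (r : seq T) (P : pred T) (F : T ->
  {mpoly K[m]}) u :
  ad_poly x (\sum_(i <- r | P i) F i) u = \sum_(i <- r | P i) ad_poly x (F i) u.
Proof.
exact: (big_morph (fun f => ad_poly x f u) (fun f g => ad_polyDl f g u)
  (ad_poly0l u)).
Qed.

Lemma ad_polyX e u : ad_poly x 'X_[e] u = ad_monomial x e u.
Proof. by rewrite /ad_poly msuppX big_seq1 mcoeffX eqxx scale1r. Qed.

Lemma ad_poly1 u : ad_poly x 1 u = u.
Proof. by rewrite -mpolyX0 ad_polyX ad_monomial0. Qed.

Lemma ad_poly_linear f : linear (ad_poly x f).
Proof.
move=> a u v; rewrite /ad_poly scaler_sumr -big_split /=.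
apply: eq_bigr => e _; rewrite ad_monomial_linear scalerDr.
by rewrite !scalerA mulrC.
Qed.

Lemma ad_poly_sub (S : set L) f u : subspace S ->
  (forall i u, S u -> S [lie u, x i]) -> S u -> S (ad_poly x f u).
Proof.
move=> Ss Sx Su; apply: subspace_sum => // e _; apply: subspaceZ => //.
exact: ad_monomial_sub.
Qed.

Lemma ad_poly_ideal (I : set L) f u : lie_ideal I -> I u -> I (ad_poly x f u).
Proof. by move=> [Is Ii]; apply: ad_poly_sub => // i v; exact: Ii. Qed.

Lemma ad_poly0r f : ad_poly x f 0 = 0.
Proof.
apply: (@ad_poly_ideal [set 0]) => //.
by split; [split=> [//|a u v -> ->] | move=> u v ->];
  rewrite /= ?lieb0l ?scaler0 ?addr0.
Qed.

Lemma ad_polyDr f u v : ad_poly x f (u + v) = ad_poly x f u + ad_poly x f v.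
Proof. by have := ad_poly_linear f 1 u v; rewrite !scale1r. Qed.

Lemma ad_polyZr a f u : ad_poly x f (a *: u) = a *: ad_poly x f u.
Proof. by have := ad_poly_linear f a u 0; rewrite !addr0 ad_poly0r addr0. Qed.

Lemma ad_polyNr f u : ad_poly x f (- u) = - ad_poly x f u.
Proof. by rewrite -scaleN1r ad_polyZr scaleN1r. Qed.

Lemma ad_monomial_lcs k e u :
  @lcs _ L k.+1 u -> @lcs _ L (k + mdeg e).+1 (ad_monomial x e u).
Proof.
rewrite mdegE -[\sum_i _]big_enum /= /ad_monomial.
elim: (enum _) k u => [|i s IHs] k u Lu /=; first by rewrite big_nil addn0.
rewrite big_cons addnA; apply: IHs; elim: (e i) => [|n IHn];
  first by rewrite addn0.
by rewrite addnS; exact: lcsS_bracket.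
Qed.

Hypothesis Lmet : metabelian L.

Lemma ad_commute u v w : @lcs _ L 2 u ->
  [lie [lie u, v], w] = [lie [lie u, w], v].
Proof.
move=> Lu; rewrite lieb_leibniz (Lmet Lu (lcs2_bracket v w)).
exact: addr0.
Qed.

Lemma lcs2_lieb u v : @lcs _ L 2 u -> @lcs _ L 2 [lie u, v].
Proof. by move=> Lu; have [_ h] := lie_ideal_lcs L 2; exact: h. Qed.

Lemma ad_monomial_lieb e u v : @lcs _ L 2 u ->
  ad_monomial x e [lie u, v] = [lie ad_monomial x e u, v].
Proof.
move=> Lu.
suff [] : @lcs _ L 2 (ad_monomial x e u) /\ ad_monomial x e [lie u, v] =
  [lie ad_monomial x e u, v] by [].
apply: (@ad_monomial_rel _ _ _ x (fun w w' =>
  @lcs _ L 2 w /\ w' = [lie w, v])) => //.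
move=> i w _ [Lw ->]; split; first exact: lcs2_lieb.
exact: ad_commute.
Qed.

Lemma ad_poly_lieb f u v : @lcs _ L 2 u ->
  ad_poly x f [lie u, v] = [lie ad_poly x f u, v].
Proof.
move=> Lu; rewrite lieb_suml; apply: eq_bigr => e _.
by rewrite liebZl ad_monomial_lieb.
Qed.

Lemma iter_ad_lcs2 n v u : @lcs _ L 2 u -> @lcs _ L 2 (iter n (ad v) u).
Proof. by move=> Lu; elim: n => //= n; exact: lcs2_lieb. Qed.

Lemma iter_ad_comm n v w u : @lcs _ L 2 u ->
  iter n (ad v) (ad w u) = ad w (iter n (ad v) u).
Proof.
move=> Lu; elim: n => //= n ->; rewrite /ad.
by rewrite ad_commute //; exact: iter_ad_lcs2.
Qed.

Lemma ad_monomialU e i u : @lcs _ L 2 u ->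
  ad_monomial x (U_(i) + e)%MM u = [lie ad_monomial x e u, x i].
Proof.
move=> Lu; rewrite -ad_monomial_lieb // /ad_monomial.
pose step e' w j := iter (e' j) (ad (x j)) w.
(* off the coordinate i the two exponents agree *)
have skip (s : seq 'I_m) w : i \notin s ->
    foldl (step (U_(i) + e)%MM) w s = foldl (step e) w s.
  elim: s w => //= j s IHs w; rewrite inE negb_or => /andP[ij /IHs ->].
  by congr foldl; rewrite /step mnmDE mnm1E (negPf ij).
have := mem_enum 'I_m i; have := enum_uniq 'I_m; rewrite inE /=.
elim: (enum _) u Lu => //= j s IHs u Lu /andP[js us]; rewrite inE.
have [ij _|ij /= si] := eqVneq i j.
  rewrite -ij in js *; rewrite -/(step _) skip //; congr foldl.
  by rewrite mnmDE mnm1E eqxx add1n iterSr.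
rewrite mnmDE mnm1E (negPf ij) add0n -[[lie u, x i]]/(ad (x i) u).
by rewrite iter_ad_comm // IHs //; exact: iter_ad_lcs2.
Qed.

(** The set of all [ad_poly x f u] is a [K[t_1, ..., t_m]]-submodule of the
    derived algebra. *)
Lemma ad_poly_mulX f i u : @lcs _ L 2 u ->
  ad_poly x ('X_i * f) u = [lie ad_poly x f u, x i].
Proof.
move=> Lu; rewrite {1}[f]mpolyE mulr_sumr ad_poly_suml lieb_suml.
apply: eq_bigr => e _; rewrite -scalerAr ad_polyZl -mpolyXD ad_polyX.
by rewrite ad_monomialU // liebZl.
Qed.

End AdMonomial.

Lemma ad_poly_hom (K : fieldType) (m : nat) (L M : lieAlgType K)
    (h : L -> M) (x : 'I_m -> L) f u : lie_hom h ->
  h (ad_poly x f u) = ad_poly (h \o x) f (h u).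
Proof.
move=> hh; rewrite lie_hom_sum //; apply: eq_bigr => e _.
rewrite (lie_homZ hh); congr (_ *: _).
apply: (@ad_monomial_rel _ _ _ _ x (h \o x) (fun w w' => h w = w')) => //.
by move=> i w _ <-; exact: hh.2.
Qed.

(** * Normal automorphisms; generalized inner automorphisms are normal *)

Section NormalAutomorphisms.
Variables (K : fieldType) (m c : nat).
Local Notation L := (free_mn K m c).
Local Notation x := (@mn_gen K m c).
Implicit Types (phi psi : lie_aut L) (a b : K) (u v w : L).

Definition scalar_mod_derived phi a : Prop :=
  forall u, @lcs _ L 2 (phi u - a *: u).

Lemma scalar_mod_derived_gen phi a :
  (forall i, @lcs _ L 2 (phi (x i) - a *: x i)) -> scalar_mod_derived phi a.
Proof.
have ph := aut_hom phi; apply: mn_gen_generates => [|u v _ _].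
- split=> [|b u v Lu Lv]; first by rewrite (lie_hom0 ph) scaler0 subr0;
  exact: lcs0.
  rewrite ph.1 scalerDr scalerA mulrC -scalerA opprD addrACA -scalerBr.
  by apply: lcsD => //; exact: lcsZ.
- by rewrite ph.2; apply: lcsB; [|apply: lcsZ]; exact: lcs2_bracket.
Qed.

Lemma scalar_mod_derivedM phi psi a b :
  scalar_mod_derived phi a -> scalar_mod_derived psi b ->
  scalar_mod_derived (phi * psi)%g (a * b).
Proof.
move=> pa pb u; rewrite -[X in @lcs _ _ 2 X](subrKA (a *: psi u)).
have -> : a *: psi u - (a * b) *: u = a *: (psi u - b *: u).
  by rewrite scalerBr scalerA.
by apply: lcsD; [exact: pa | apply: lcsZ; exact: pb].
Qed.

Lemma scalar_mod_derived_scaling (a : Kunit K) :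
  scalar_mod_derived (scaling K m c a) (uval a).
Proof.
apply: scalar_mod_derived_gen => i; rewrite scalingE subrr.
exact: lcs0.
Qed.

Lemma normal_autM phi psi :
  normal_aut L phi -> normal_aut L psi -> normal_aut L (phi * psi)%g.
Proof.
move=> pn qn I Ii; rewrite -[RHS](pn I Ii) -[in RHS](qn I Ii).
by rewrite -image_comp.
Qed.

Lemma aut_mulVK phi : cancel phi (phi^-1)%g.
Proof. by move=> u; have := congr1 (fun f : lie_aut L => f u) (mulVg phi). Qed.

Lemma aut_mulKV phi : cancel (phi^-1)%g phi.
Proof. by move=> u; have := congr1 (fun f : lie_aut L => f u) (mulgV phi). Qed.

Lemma normal_autV phi : normal_aut L phi -> normal_aut L (phi^-1)%g.
Proof.
move=> pn I Ii; rewrite -{1}(pn I Ii) image_comp.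
rewrite (_ : _ \o _ = idfun) ?image_id //.
by apply/funext => u; exact: aut_mulVK.
Qed.

Lemma is_subgroup_normal_aut : is_subgroup (normal_aut L).
Proof.
split; [move=> I Ii | exact: normal_autM | exact: normal_autV].
exact: image_id.
Qed.

Lemma normal_aut_closed phi (I : set L) u :
  normal_aut L phi -> lie_ideal I -> I u -> I (phi u).
Proof. by move=> pn Ii Iu; rewrite -(pn I Ii); exists u. Qed.

Definition normal_ia_aut : set (lie_aut L) :=
  [set phi | normal_aut L phi /\ scalar_mod_derived phi 1].

(** [phi] equals [1 + delta] with [delta u = \sum_j [u, x_j] f_j] on all of
    [L]: [delta] is a derivation since the [f_j] act on the abelian ideal [L']
    by operators commuting with every [ad v], and a derivation into an abelian
    ideal makes [1 + delta] multiplicative. *)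
Lemma ginner_normal_ia : @ginner_aut K m c `<=` normal_ia_aut.
Proof.
move=> phi [f phix].
have met : metabelian L := @mn_metabelian K m c.
have ph := aut_hom phi.
pose delta u := \sum_j ad_poly x (f j) [lie u, x j].
have dlin : linear delta.
  move=> a u v; rewrite scaler_sumr -big_split /=; apply: eq_bigr => j _.
  by rewrite liebDl liebZl ad_poly_linear.
have dlcs k u : @lcs _ L k.+1 u -> @lcs _ L k.+2 (delta u).
  move=> Lu; rewrite /delta; apply: (subspace_sum (lcs_subspace L _)) => j _.
  by apply: ad_poly_ideal (lie_ideal_lcs L _) _; exact: lcsS_bracket.
have dideal (I : set L) u : lie_ideal I -> I u -> I (delta u).
  move=> Ii Iu; apply: subspace_sum => [|j _]; first by case: Ii.
  by apply: ad_poly_ideal => //; case: Ii => _; apply.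
have dder u v : delta [lie u, v] = [lie delta u, v] + [lie u, delta v].
  rewrite lieb_suml lieb_sumr -big_split /=; apply: eq_bigr => j _.
  rewrite lieb_leibniz ad_polyDr ad_poly_lieb //; last exact: lcs2_bracket.
  congr (_ + _); rewrite liebC [RHS]liebC ad_polyNr ad_poly_lieb //.
  exact: lcs2_bracket.
have d2 u : @lcs _ L 2 (delta u) := dlcs 0%N u Logic.I.
have psih : lie_hom (fun u => u + delta u).
  split=> [a u v|u v]; first by rewrite dlin scalerDr addrACA.
  rewrite dder liebDl !liebDr (met _ _ (d2 u) (d2 v)) addr0.
  by rewrite [[lie delta u, v] + _]addrC addrA.
have phiE : phi =1 (fun u => u + delta u) by apply: mn_hom_ext.
split=> [I Ii|u]; last by rewrite phiE scale1r addrC addKr.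
have [Is _] := Ii.
(* surjectivity on I, by downward induction along the lower central series *)
have surj n u : (n <= c)%N -> I u -> @lcs _ L (c - n).+1 u ->
  exists2 v, I v & phi v = u.
  elim: n u => [|n IHn] u nc Iu Lu.
    exists 0; first by case: Is.
    by rewrite (lie_hom0 ph) (mn_lcs_eq0 _ Lu) // subn0.
  have [||v Iv phiv] := IHn (delta u) (ltnW nc); first exact: dideal.
    by rewrite -(subnSK nc); exact: dlcs.
  exists (u - v); first exact: subspaceB.
  by rewrite (lie_homB ph) phiv phiE addrK.
apply/seteqP; split=> [_ [u Iu <-]|u Iu].
  by rewrite phiE; apply: subspaceD => //; exact: dideal.
have [|v Iv <-] := surj c u (leqnn c) Iu; first by rewrite subnn.
by exists v.
Qed.

End NormalAutomorphisms.

(** * The metabelian Lie algebra of pairs of polynomials *)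

Section AffineModel.
Variable K : fieldType.
Local Notation P := {poly K}.

(** The pair [(p, q)] stands for the affine transformation of the line over
    [K[T]] with translation part [p] and linear part [T q].  The factor [T]
    makes the algebra residually nilpotent, so that one variable suffices to
    keep track of degrees. *)
Definition aff : Type := (P * P)%type.
HB.instance Definition _ := GRing.Lmodule.on aff.

Definition aff_lieb (u v : aff) : aff := ('X * (u.1 * v.2 - v.1 * u.2), 0).

Lemma aff_lieb_linearl v : linear (aff_lieb^~ v).
Proof.
move=> a u u'; congr (_, _); rewrite /= ?scaler0 ?addr0 //.
by rewrite -!mul_polyC; ring.
Qed.

Lemma aff_lieb_linearr u : linear (aff_lieb u).
Proof.
move=> a v v'; congr (_, _); rewrite /= ?scaler0 ?addr0 //.
by rewrite -!mul_polyC; ring.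
Qed.

Lemma aff_liebvv u : aff_lieb u u = 0.
Proof. by rewrite /aff_lieb subrr mulr0. Qed.

Lemma aff_lieb_jacobi u v w :
  aff_lieb u (aff_lieb v w) + aff_lieb v (aff_lieb w u) +
  aff_lieb w (aff_lieb u v) = 0.
Proof.
congr (_, _); rewrite /= ?addr0 //; ring.
Qed.

HB.instance Definition _ := Lmodule_isLie.Build K aff
  aff_lieb_linearl aff_lieb_linearr aff_liebvv aff_lieb_jacobi.

Lemma aff_liebE (u v : aff) :
  [lie u, v] = ('X * (u.1 * v.2 - v.1 * u.2), 0) :> aff.
Proof. by []. Qed.

Definition aff_trunc_set d : set aff := [set u | 'X^d %| u.1 /\ u.2 = 0].

Lemma aff_trunc_subspace d : subspace (aff_trunc_set d).
Proof.
split=> [|a u v [du u0] [dv v0]]; first by split=> //; exact: dvdp0.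
split; last by rewrite /= u0 v0 scaler0 addr0.
have -> : (a *: u + v).1 = a%:P * u.1 + v.1 by rewrite mul_polyC.
by apply: dvdp_add => //; exact: dvdp_mull.
Qed.

Lemma aff_trunc_bracket d (u v : aff) :
  aff_trunc_set d u -> aff_trunc_set d.+1 [lie u, v].
Proof.
move=> [du u0]; split=> //; rewrite aff_liebE u0 mulr0 subr0 /= exprS.
by apply: dvdp_mul => //; exact: dvdp_mulr.
Qed.

Lemma lie_ideal_aff_trunc d : lie_ideal (aff_trunc_set d).
Proof.
split=> [|u v /(@aff_trunc_bracket _ _ v)[dv v0]];
  first exact: aff_trunc_subspace.
by split=> //; apply: dvdp_trans dv; exact: dvdp_exp2l.
Qed.

Definition aff_trunc d : ideal aff := Ideal (lie_ideal_aff_trunc d).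

Lemma aff_lcs d : (0 < d)%N -> @lcs _ aff d.+1 `<=` aff_trunc_set d.
Proof.
case: d => // d _; elim: d => [|d IHd].
  apply: sub_bracket_space; first exact: aff_trunc_subspace.
  by move=> u v _ _; split=> //; exact: dvdp_mulr.
apply: sub_bracket_space => [|u v Lu _]; first exact: aff_trunc_subspace.
by apply: aff_trunc_bracket; exact: IHd.
Qed.

Lemma aff_metab_nilp c d :
  (0 < d <= c)%N -> metab_nilp aff c `<=` aff_trunc_set d.
Proof.
move=> /andP[d0 dc] _ [u Lu [v Lv <-]].
apply: subspaceD; first exact: aff_trunc_subspace; last first.
  by apply: (aff_lcs d0); apply: lcs_sub Lv.
move: u Lu; apply: sub_bracket_space; first exact: aff_trunc_subspace.
move=> u v' /(@aff_lcs 1 isT)[_ u0] /(@aff_lcs 1 isT)[_ v0].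
by rewrite aff_liebE u0 v0 !mulr0 subrr mulr0; exact: (aff_trunc_subspace d).1.
Qed.

(** A homomorphism that sends [x_l] to
    [((l == j)%:R, s_l)] has as first coordinate a specialization, along the
      line spanned by [s], of
    the [j]-th Fox derivative on the free metabelian algebra. *)
Lemma aff_hom_exists m c d (y : 'I_m -> aff) : (0 < d <= c)%N ->
  exists2 f : free_mn K m c -> lie_quot (aff_trunc d),
    lie_hom f & forall i, f (mn_gen K c i) = quot_pi (aff_trunc d) (y i).
Proof.
move=> dc; apply: mn_hom_exists => u.
have ph := quot_pi_hom (aff_trunc d).
case/(metab_nilp_surj ph) => [v|v Lv <-].
  by exists (quot_repr v); exact: quot_reprK.
rewrite -(lie_hom0 ph); apply/quot_piP; rewrite subr0.
exact: aff_metab_nilp Lv.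
Qed.

Lemma aff_hom_lcs2 (L : lieAlgType K) d (f : L -> lie_quot (aff_trunc d)) u :
  lie_hom f -> @lcs _ L 2 u ->
  exists p, f u = quot_pi (aff_trunc d) (('X * p, 0) : aff).
Proof.
move=> fh /(lie_hom_lcs fh) Lu.
have ph := quot_pi_hom (aff_trunc d).
have : (quot_pi (aff_trunc d) @` @lcs _ aff 2) (f u).
  move: Lu; apply: bracket_space_surj => // v _; exists (quot_repr v) => //;
    exact: quot_reprK.
case=> -[p q] /(@aff_lcs 1 isT)[/= /dvdpP[r ->] ->] <-.
by exists r; rewrite mulrC expr1.
Qed.

Lemma aff_piP d (u v : aff) :
  quot_pi (aff_trunc d) u = quot_pi (aff_trunc d) v <->
  'X^d %| u.1 - v.1 /\ u.2 = v.2.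
Proof.
split=> [/quot_piP[duv uv]|[duv uv]].
  by split=> //; apply/eqP; rewrite -subr_eq0; apply/eqP.
by apply/quot_piP; split=> //=; rewrite uv subrr.
Qed.

Lemma dvdXn_coef d (p : P) i : 'X^d %| p -> (i < d)%N -> p`_i = 0.
Proof. by move=> /dvdpP[q ->] id; rewrite coefMXn id. Qed.

End AffineModel.

(** Modulo [T] the model is abelian and the second coordinate reads off the
    coefficient of one generator. *)
Lemma mn_gen_indep (K : fieldType) m c (b : 'I_m -> K) : (0 < c)%N ->
  @lcs _ (free_mn K m c) 2 (\sum_i b i *: mn_gen K c i) ->
  forall i, b i = 0.
Proof.
move=> c0 Lb i.
have [f fh fx] := @aff_hom_exists K m c 1 (fun j => (0, (j == i)%:R)) c0.
have [p] := aff_hom_lcs2 fh Lb.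
have ph := quot_pi_hom (aff_trunc K 1).
have fE : f (\sum_j b j *: mn_gen K c j) =
    quot_pi (aff_trunc K 1) (\sum_j b j *: ((0, (j == i)%:R) : aff K)).
  rewrite !lie_hom_sum //; apply: eq_bigr => j _.
  by rewrite (lie_homZ fh) fx -(lie_homZ ph).
rewrite fE => /aff_piP[_ /=].
rewrite (big_morph (@snd _ _ : aff K -> {poly K}) (fun _ _ => erefl) erefl).
rewrite (bigD1 i) //= eqxx big1 ?addr0 => [|j /negPf ->]; last exact: scaler0.
by move/(congr1 (coefp 0)); rewrite /coefp coefZ coef1 coef0 mulr1.
Qed.

(** * The scalar of a normal automorphism and the semidirect product *)

Section ScalarPart.
Variables (K : fieldType) (m c : nat).
Hypotheses (m2 : (2 <= m)%N) (c0 : (0 < c)%N).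
Local Notation L := (free_mn K m c).
Local Notation x := (@mn_gen K m c).
Implicit Types (phi psi : lie_aut L) (a b : K) (u v w : L).

Lemma mn_gen_notin_derived i a : @lcs _ L 2 (a *: x i) -> a = 0.
Proof.
move=> Lx; suff /(mn_gen_indep c0)/(_ i) :
    @lcs _ L 2 (\sum_j (if j == i then a else 0) *: x j) by rewrite eqxx.
rewrite (bigD1 i) //= eqxx big1 ?addr0 // => j /negPf ->.
exact: scale0r.
Qed.

Lemma scalar_mod_derived_uniq phi a b :
  scalar_mod_derived phi a -> scalar_mod_derived phi b -> a = b.
Proof.
move=> pa pb; pose i := Ordinal (ltnW m2).
apply/eqP; rewrite -subr_eq0; apply/eqP/(@mn_gen_notin_derived i).
have -> : (a - b) *: x i = (phi (x i) - b *: x i) - (phi (x i) - a *: x i).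
  by rewrite opprB [RHS]addrC addrA subrK scalerBl.
by apply: lcsB; [exact: pb | exact: pa].
Qed.

Lemma line_mod_derived_ideal v :
  lie_ideal [set u | exists a, @lcs _ L 2 (u - a *: v)].
Proof.
split; [split=> [|b u u' [a Lu] [a' Lu']]|move=> u w _].
- by exists 0; rewrite scale0r subr0; exact: lcs0.
- exists (b * a + a'); rewrite scalerDl -scalerA opprD addrACA -scalerBr.
  by apply: lcsD => //; exact: lcsZ.
- by exists 0; rewrite scale0r subr0; exact: lcs2_bracket.
Qed.

Lemma normal_aut_line phi v :
  normal_aut L phi -> exists a, @lcs _ L 2 (phi v - a *: v).
Proof.
move=> pn; apply: (normal_aut_closed pn (line_mod_derived_ideal v)).
by exists 1; rewrite scale1r subrr; exact: lcs0.
Qed.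

(** An endomorphism of [L / L'] for which every vector is an eigenvector is a
    scalar; compare the eigenvalues of [x_i], [x_k] and [x_i + x_k]. *)
Lemma normal_aut_scalar phi :
  normal_aut L phi -> exists a : Kunit K, scalar_mod_derived phi (uval a).
Proof.
move=> pn; have ph := aut_hom phi.
have [a pa] := choice (fun i => normal_aut_line (x i) pn).
have aE i k : i != k -> a i = a k.
  move=> ik; have ki : k != i by rewrite eq_sym.
  have [b pb] := normal_aut_line (x i + x k) pn.
  have : @lcs _ L 2 (\sum_j ((j == i)%:R * (a i - b) + (j == k)%:R * (a k -
    b)) *: x j).
    rewrite (bigD1 i) //= (bigD1 k) //= !eqxx (negPf ik) (negPf ki).
    rewrite big1 => [|j /andP[/negPf -> /negPf ->]];
      last by rewrite !mul0r add0r scale0r.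
    rewrite !mul0r !mul1r add0r !addr0.
    have := lcsB (lcsB pb (pa i)) (pa k).
    rewrite (lie_homD ph) scalerDr !opprB opprD.
    rewrite [X in @lcs _ _ _ X -> _](AC (2*2*2*2) ((1*6)*(2*8)*((5*3)*(7*4)))).
    by rewrite /= !subrr !add0r -!scalerBl.
  move=> /(mn_gen_indep c0 (b := fun j => _)) h; have := h i; have := h k.
  rewrite !eqxx (negPf ik) (negPf ki) !mul0r !mul1r add0r addr0.
  by move=> /subr0_eq -> /subr0_eq.
pose i0 := Ordinal (ltnW m2).
have pa0 : scalar_mod_derived phi (a i0).
  by apply: scalar_mod_derived_gen => i; have [<- //|/aE <-] := eqVneq i i0.
suff ua : a i0 \is a GRing.unit by exists (MkKunit ua).
rewrite unitfE; apply/eqP => a0.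
(* a zero scalar would put the image of phi, which is everything, in L' *)
rewrite a0 in pa0.
have [g gK Kg] := aut_bij phi.
have := pa0 (g (x i0)); rewrite Kg scale0r subr0 -[x i0]scale1r.
by move/mn_gen_notin_derived/eqP; rewrite oner_eq0.
Qed.

Lemma normal_ia_subgroup : is_subgroup (@normal_ia_aut K m c).
Proof.
have [n1 nM nV] := is_subgroup_normal_aut K m c.
split=> [|phi psi [pn p1] [qn q1]|phi [pn p1]].
- by split=> // u; rewrite scale1r subrr; exact: lcs0.
- split; first exact: nM.
  by rewrite -[1]mulr1; exact: scalar_mod_derivedM.
- split=> [|u]; first exact: nV.
  rewrite -{2}[u](aut_mulKV phi) scale1r -opprB -[X in _ - X]scale1r.
  by apply: lcsN; exact: p1.
Qed.

Lemma scalar_part_exists : exists alpha : lie_aut L -> Kunit K, [/\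
  forall phi, normal_aut L phi -> scalar_mod_derived phi (uval (alpha phi)),
  forall phi (a : Kunit K),
    normal_aut L phi -> scalar_mod_derived phi (uval a) -> alpha phi = a
& forall phi psi, normal_aut L phi -> normal_aut L psi ->
    alpha (phi * psi)%g = (alpha phi * alpha psi)%g].
Proof.
have [n1 nM nV] := is_subgroup_normal_aut K m c.
have ex phi : exists a : Kunit K,
    normal_aut L phi -> scalar_mod_derived phi (uval a).
  have [/normal_aut_scalar[a pa]|np] := pselect (normal_aut L phi);
    last by exists 1%g.
  by exists a.
have [alpha alphaP] := choice ex; exists alpha.
have alphaE phi (a : Kunit K) : normal_aut L phi ->
  scalar_mod_derived phi (uval a) -> alpha phi = a.
  move=> pn pa; apply: val_inj; exact: scalar_mod_derived_uniq (alphaP _ pn) pa.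
have alphaM phi psi : normal_aut L phi -> normal_aut L psi ->
    alpha (phi * psi)%g = (alpha phi * alpha psi)%g.
  move=> pn qn; apply: alphaE; first exact: nM.
  by apply: scalar_mod_derivedM; exact: alphaP.
by split.
Qed.

Hypothesis scaling_normal : forall a : Kunit K, normal_aut L (scaling K m c a).

(** [phi] is sent to the pair of its scalar [a] and of the normal IA
    automorphism [scaling a^-1 * phi]. *)
Theorem normal_aut_sdprod :
  group_iso (normal_aut L) (sdprod (scaling K m c) (@normal_ia_aut K m c)).
Proof.
set s := scaling K m c; set H := @normal_ia_aut K m c.
have [n1 nM nV] := is_subgroup_normal_aut K m c.
have [h1 hM hV] := normal_ia_subgroup.
have [alpha [alphaP alphaE alphaM]] := scalar_part_exists.
have conjH h (a : Kunit K) : H h -> H (h ^ s a)%g.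
  move=> [hn h0]; split; first by apply: (nM); [apply: nV;
    exact: scaling_normal | exact: nM].
  rewrite /conjg -sd_actV -[1](mulVf (_ : uval a != 0)).
    rewrite -[X in _ * X]mul1r.
    apply: scalar_mod_derivedM; first exact: scalar_mod_derived_scaling.
    by apply: scalar_mod_derivedM => //; exact: scalar_mod_derived_scaling.
  by rewrite -unitfE; exact: uvalP.
have part phi : normal_aut L phi -> H ((s (alpha phi))^-1 * phi)%g.
  move=> pn; split; first by apply: nM => //; apply: nV; exact: scaling_normal.
  rewrite -sd_actV -[1](mulVf (_ : uval (alpha phi) != 0)).
    apply: scalar_mod_derivedM; last exact: alphaP.
    exact: scalar_mod_derived_scaling.
  by rewrite -unitfE; exact: uvalP.
split => //.
  split=> [//|[a g] [b h] /= Hg Hh|[a g] Hg]; first by apply: hM;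
    [exact: conjH|].
  by have := conjH _ a^-1%g (hV _ Hg); rewrite /s sd_actV.
exists (fun phi => SdPair s (alpha phi) ((s (alpha phi))^-1 * phi)%g); split.
  split=> [phi /part //|phi psi _ _ e|[a h] [hn h0]].
    have e1 : alpha phi = alpha psi := congr1 (@sd1 _ _ s) e.
    have : ((s (alpha phi))^-1 * phi = (s (alpha psi))^-1 * psi)%g :=
      congr1 (@sd2 _ _ s) e.
    by rewrite e1 => /mulgI.
  exists (s a * h)%g; first by apply: nM => //; exact: scaling_normal.
  have -> : alpha (s a * h)%g = a; last by rewrite mulKg.
  apply: alphaE; first by apply: nM => //; exact: scaling_normal.
  by rewrite -[uval a]mulr1; apply: scalar_mod_derivedM => //;
    exact: scalar_mod_derived_scaling.
move=> phi psi pn qn; congr SdPair; first exact: alphaM.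
rewrite alphaM // /s scalingM /conjg /= invgM.
by rewrite !mulgA mulgK.
Qed.

Theorem normal_aut_units : c = 1%N -> group_iso (normal_aut L) [set: Kunit K].
Proof.
move=> c1; have [alpha [alphaP alphaE alphaM]] := scalar_part_exists.
split; [exact: is_subgroup_normal_aut | by split | exists alpha; split => //].
split=> // [phi psi|a _].
  rewrite !inE => pn qn e; apply: lie_aut_ext => u.
  have L0 v : @lcs _ L 2 v -> v = 0 by apply: mn_lcs_eq0; rewrite c1.
  rewrite (subr0_eq (L0 _ (alphaP _ pn u))) e.
  by rewrite (subr0_eq (L0 _ (alphaP _ qn u))).
exists (scaling K m c a) => //; apply: alphaE => //.
exact: scalar_mod_derived_scaling.
Qed.

End ScalarPart.

(** * Independence of monomials and evaluation in the polynomial model *)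

Section Independence.
Variables (K : fieldType) (m : nat).
Hypothesis charK : [pchar K] =i pred0.

(** This is how characteristic 0 separates exponents: it suffices to evaluate
    at powers of 2. *)
Lemma exp2_inj : injective (fun n => 2 ^+ n : K).
Proof.
suff le n k : (n <= k)%N -> 2 ^+ n = 2 ^+ k :> K -> n = k.
  move=> n k e; have [/le|/ltnW/le h] := leqP n k; first exact.
  by apply/esym/h.
move=> nk; rewrite -(subnK nk) exprD; move: (k - n)%N => d.
have two0 : (2 : K) != 0 by move/pcharf0P: charK => ->.
rewrite -{1}[2 ^+ n]mul1r => /(mulIf (expf_neq0 n two0))/eqP.
rewrite -natrX eq_sym -subr_eq0 -[_ - 1]/(_ - 1%:R) -natrB ?expn_gt0 //.
move/pcharf0P: charK => ->; rewrite subn_eq0 -[1%N]/(2 ^ 0)%N leq_exp2l //.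
by rewrite leqn0 => /eqP ->.
Qed.

Definition mon_eval (s : 'I_m -> K) (e : 'X_{1..m}) : K := \prod_i s i ^+ e i.

(** Dedekind's argument for characters of the torus: multiplying one
    coordinate of [s] by 2 and subtracting a multiple of the original relation
    eliminates the first monomial.  The coordinates of [s] range over nonzero
    scalars only, because [s i / s k] occurs in the application. *)
Lemma mon_eval_indep (r : seq 'X_{1..m}) (a : 'X_{1..m} -> K) : uniq r ->
  (forall s, (forall i, s i != 0) -> \sum_(e <- r) a e * mon_eval s e = 0) ->
  {in r, forall e, a e = 0}.
Proof.
elim: r a => //= e0 r IHr a /andP[e0r ur] ae0.
have two0 : (2 : K) != 0 by move/pcharf0P: charK => ->.
have ar0 : {in r, forall e, a e = 0}.
  move=> e er; have /eqP/mnmP/existsNP[l /eqP el] : e != e0.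
    by apply: contraNneq e0r => <-.
  have /(_ e er)/eqP : {in r, forall e, a e * (2 ^+ e l - 2 ^+ e0 l) = 0}.
    apply: IHr => // s s0; pose s' i := if i == l then 2 * s i else s i.
    have s'0 i : s' i != 0 by rewrite /s'; case: ifP => _; rewrite ?mulf_neq0.
    have s'E e' : mon_eval s' e' = 2 ^+ e' l * mon_eval s e'.
      rewrite /mon_eval (bigD1 l) // [in RHS](bigD1 l) //= /s' eqxx exprMn
        -mulrA.
      by do 2!congr (_ * _); apply: eq_bigr => i /negPf ->.
    have := ae0 _ s'0; rewrite big_cons s'E => /eqP;
      rewrite addrC addr_eq0 => /eqP sum'.
    have := ae0 _ s0; rewrite big_cons => /eqP;
      rewrite addrC addr_eq0 => /eqP sum.
    transitivity (\sum_(e1 <- r) a e1 * mon_eval s' e1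
        - 2 ^+ e0 l * \sum_(e1 <- r) a e1 * mon_eval s e1).
      rewrite mulr_sumr -sumrB; apply: eq_bigr => e1 _; rewrite s'E; ring.
    rewrite sum' sum; ring.
  rewrite mulf_eq0 subr_eq0 => /orP[/eqP //|/eqP/exp2_inj e_l].
  by rewrite e_l eqxx in el.
move=> e; rewrite inE => /predU1P[->|]; last exact: ar0.
have := ae0 (fun=> 1) (fun=> oner_neq0 _).
rewrite big_cons big_seq big1 => [|e' /ar0 ->]; last by rewrite mul0r.
rewrite addr0 /mon_eval big1 ?mulr1 // => i _; exact: expr1n.
Qed.

End Independence.

Section AffineEval.
Variables (K : fieldType) (m : nat) (s : 'I_m -> K) (a : 'I_m -> {poly K}).
Let y i : aff K := (a i, (s i)%:P).

Lemma aff_ad_monomial e (p : {poly K}) :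
  ad_monomial y e ((p, 0) : aff K) = (mon_eval s e *: (p * 'X^(mdeg e)), 0).
Proof.
rewrite /mon_eval mdegE -!big_enum /= /ad_monomial.
have it n i (q : {poly K}) : iter n (ad (y i)) ((q, 0) : aff K) =
  (s i ^+ n *: (q * 'X^n), 0).
  elim: n => [|n IHn] /=; first by rewrite !expr0 mulr1 scale1r.
  rewrite IHn /ad aff_liebE /= mulr0 subr0 -!mul_polyC !exprS polyCM.
  by congr (_, _); ring.
elim: (enum _) p => [|i r IHr] p /=; first by rewrite !big_nil mulr1 scale1r.
rewrite it IHr !big_cons exprD -!mul_polyC polyCM.
by congr (_, _); ring.
Qed.

Lemma aff_ad_poly_coef f (p : {poly K}) d :
  ((ad_poly y f ((p, 0) : aff K)).1)`_d =
  \sum_(e <- msupp f) f@_e * mon_eval s e * (p * 'X^(mdeg e))`_d.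
Proof.
rewrite /ad_poly (big_morph (@fst _ _ : aff K -> {poly K}) (fun _ _ =>
  erefl) erefl).
rewrite coef_sum; apply: eq_bigr => e _.
by rewrite aff_ad_monomial /= !coefZ mulrA.
Qed.

End AffineEval.

(** * Normal IA automorphisms are generalized inner *)

Section NormalIAGeneralized.
Variables (K : fieldType) (m c : nat).
Local Notation L := (free_mn K m c).
Local Notation x := (@mn_gen K m c).
Let met : metabelian L := @mn_metabelian K m c.
Let gen : lie_generates x := @mn_gen_generates K m c.

Lemma cyclic_ideal_derived u : @lcs _ L 2 u ->
  lie_ideal [set w : L | exists f, w = ad_poly x f u].
Proof.
move=> Lu; apply: (lie_ideal_gen gen).
  split=> [|a _ _ [f ->] [g ->]]; first by exists 0; rewrite ad_poly0l.
  by exists (a *: f + g); rewrite ad_poly_linearl.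
by move=> i _ [f ->]; exists ('X_i * f); rewrite ad_poly_mulX.
Qed.

Lemma cyclic_ideal v : lie_ideal [set w : L | exists a (f : 'I_m ->
  {mpoly K[m]}),
  w = a *: v + \sum_j ad_poly x (f j) [lie v, x j]].
Proof.
apply: (lie_ideal_gen gen).
  split=> [|a _ _ [b [f ->]] [d [g ->]]].
    by exists 0, (fun=> 0); rewrite scale0r add0r big1 // => j _;
      rewrite ad_poly0l.
  exists (a * b + d), (fun j => a *: f j + g j).
  rewrite scalerDr addrACA scalerA -scalerDl; congr (_ + _).
  rewrite scaler_sumr -big_split; apply: eq_bigr => j _ /=.
  by rewrite ad_poly_linearl.
move=> i _ [b [f ->]];
  exists 0, (fun j => (if j == i then b%:MP else 0) + 'X_i * f j).
rewrite scale0r add0r liebDl liebZl lieb_suml.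
rewrite [RHS](eq_bigr (fun j =>
    ad_poly x (if j == i then b%:MP else 0) [lie v, x j] +
    [lie ad_poly x (f j) [lie v, x j], x i])).
  rewrite big_split /=; congr (_ + _); rewrite (bigD1 i) //= eqxx big1.
    by rewrite addr0 -[b%:MP]mulr1 mul_mpolyC ad_polyZl ad_poly1.
  by move=> j /negPf ->; rewrite ad_poly0l.
move=> j _; rewrite ad_polyDl ad_poly_mulX //; exact: lcs2_bracket.
Qed.

(** The right-hand sides, with [a] and [f] arbitrary, make up the ideal
    generated by [x i]. *)
Lemma normal_gen_expand phi a i : (0 < c)%N ->
  normal_aut L phi -> scalar_mod_derived phi a ->
  exists f : 'I_m -> {mpoly K[m]},
    phi (x i) = a *: x i + \sum_j ad_poly x (f j) [lie x i, x j].
Proof.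
move=> c0 pn pa.
have [|b [f phix]] := normal_aut_closed pn (cyclic_ideal (x i)) (u := x i).
  exists 1, (fun=> 0); rewrite scale1r big1 ?addr0 // => j _.
  exact: ad_poly0l.
exists f; rewrite phix; congr (_ *: _ + _).
apply: subr0_eq; apply: (mn_gen_notin_derived c0 (i := i)).
have -> : (b - a) *: x i =
    phi (x i) - a *: x i - \sum_j ad_poly x (f j) [lie x i, x j].
  by rewrite phix addrAC addrK scalerBl.
apply: lcsB; first exact: pa.
apply: (subspace_sum (lcs_subspace L 2)) => j _.
by apply: ad_poly_ideal (lie_ideal_lcs L 2) _; exact: lcs2_bracket.
Qed.

Hypothesis charK : [pchar K] =i pred0.

(** Choose a homomorphism [rho] to the model with [x_l] sent to
    [((l == j)%:R, s_l)].  It kills [v = x_i + b x_k] for [b = - s_i / s_k],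
    hence kills [phi v].  But up to a nonzero factor [rho (phi v)] is
    [T g(T s)] with [g = f_ij - f_kj], so all homogeneous components of [g] of
    degree less than [c - 1] vanish at [s].  As [s] varies over the points with
    nonzero coordinates, the corresponding coefficients of [g] are 0. *)
Lemma normal_ia_coef_indep phi (f : 'I_m -> 'I_m -> {mpoly K[m]}) i k j e :
  normal_aut L phi ->
  (forall i, phi (x i) = x i + \sum_l ad_poly x (f i l) [lie x i, x l]) ->
  i != j -> k != j -> ((mdeg e).+1 < c)%N -> (f i j)@_e = (f k j)@_e.
Proof.
move=> pn phix ij kj ec; have ph := aut_hom phi.
suff /eqP : (f i j - f k j)@_e = 0 by rewrite mcoeffB subr_eq0 => /eqP.
have [eg|] := boolP (e \in msupp (f i j - f k j)); last exact: memN_msupp_eq0.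
pose g := f i j - f k j; rewrite -/g in eg *.
suff /(_ e eg) : {in msupp g, forall e', g@_e' * (mdeg e' == mdeg e)%:R = 0}.
  by rewrite eqxx mulr1.
apply: (mon_eval_indep charK); first exact: msupp_uniq.
move=> s s0.
have c0 : (0 < c <= c)%N by rewrite leqnn andbT (leq_trans _ ec).
pose y l : aff K := ((l == j)%:R, (s l)%:P).
have [rho rh rx] := aff_hom_exists y c0.
pose pi := quot_pi (aff_trunc K c); have pih : lie_hom pi := quot_pi_hom _.
pose z l : aff K := (- ('X * (s l)%:P), 0).
have rxy : rho \o x = pi \o y by apply/funext => l; exact: rx.
have rphi l : l != j ->
  rho (phi (x l)) = rho (x l) + pi (ad_poly y (f l j) (z l)).
  move=> lj; rewrite phix (lie_homD rh) lie_hom_sum //; congr (_ + _).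
  have term t : rho (ad_poly x (f l t) [lie x l, x t]) =
      pi (ad_poly y (f l t) ([lie y l, y t])).
    by rewrite (ad_poly_hom _ _ _ rh) rxy rh.2 !rx -pih.2 -(ad_poly_hom _ _ _
      pih).
  rewrite (bigD1 j) //= term big1 => [|t tj].
    rewrite addr0 aff_liebE /= (negPf lj) eqxx mul0r mul1r sub0r mulrN.
    by [].
  by rewrite term aff_liebE /= (negPf lj) (negPf tj) !mul0r subrr mulr0
    ad_poly0r (lie_hom0 pih).
(* chosen so that rho kills x_i + b x_k *)
pose b := - (s i / s k).
have bk : b * s k = - s i by rewrite /b mulNr divfK.
pose v := x i + b *: x k.
have rv : rho v = 0.
  rewrite /v (lie_homD rh) (lie_homZ rh) !rx -(lie_homZ pih) -(lie_homD pih).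
  rewrite -(lie_hom0 pih); congr pi; congr (_, _) => /=.
    by rewrite (negPf ij) (negPf kj) scaler0 addr0.
  by rewrite -mul_polyC -polyCM bk polyCN subrr.
have bz : b *: z k = - z i.
  congr (_, _) => /=; last by rewrite scaler0 oppr0.
  by rewrite opprK scalerN scalerAr -mul_polyC -polyCM bk polyCN mulrN opprK.
have : rho (phi v) = pi (ad_poly y g (z i)).
  rewrite (lie_homD ph) (lie_homZ ph) (lie_homD rh) (lie_homZ rh).
  rewrite (rphi i ij) (rphi k kj) scalerDr addrACA -(lie_homZ rh).
  rewrite -(lie_homD rh) -/v rv add0r -(lie_homZ pih) -(lie_homD pih).
  by rewrite -ad_polyZr bz ad_polyNr ad_polyBl.
have -> : rho (phi v) = 0.
  exact: (normal_aut_closed pn (lie_ideal_ker rh)).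
rewrite -(lie_hom0 pih) => /esym/aff_piP[/= dvd _].
have := dvdXn_coef dvd ec; rewrite subr0 aff_ad_poly_coef.
(* the coefficient at T^(|e| + 1) selects the monomials of degree |e| *)
rewrite (eq_bigr (fun e' =>
  - s i * (g@_e' * (mdeg e' == mdeg e)%:R * mon_eval s e'))).
  by rewrite -mulr_sumr => /eqP;
    rewrite mulf_eq0 oppr_eq0 (negPf (s0 i)) => /eqP.
move=> e' _; have -> : -
  ('X * (s i)%:P) * 'X^(mdeg e') = (- s i)%:P * 'X^((mdeg e').+1).
  by rewrite exprS polyCN; ring.
by rewrite coefCM coefXn eqSS eq_sym; ring.
Qed.

(** [f_ij] can be replaced by an [f_j] that does not depend on [i]: the two
    differ by monomials of degree at least [c - 1], which send [[x_i, x_j]]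
    into [L^(c+1) = 0]. *)
Lemma normal_ia_ginner : (0 < c)%N -> (3 <= m)%N ->
  @normal_ia_aut K m c `<=` @ginner_aut K m c.
Proof.
move=> c0 m3 phi [pn p1].
have [f phix1] := choice (fun i => normal_gen_expand i c0 pn p1).
have phix i : phi (x i) = x i + \sum_j ad_poly x (f i j) [lie x i, x j].
  by rewrite phix1 scale1r.
(* o j is any index other than j; off j, the j-th column of f is
   constant up to terms of high degree *)
have ex j : exists i : 'I_m, i != j.
  have /card_gt0P[i] : (0 < #|predC1 j|)%N by rewrite cardC1 card_ord -subn1
    subn_gt0 ltnW.
  by exists i.
have [o oj] := choice ex.
exists (fun j => f (o j) j) => i; rewrite phix; congr (_ + _).
apply: eq_bigr => j _; have [->|ij] := eqVneq i j.
  by rewrite liebvv !ad_poly0r.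
apply/eqP; rewrite -subr_eq0 -ad_polyBl; apply/eqP.
rewrite /ad_poly big1_seq // => e _.
have [ec|ec] := ltnP (mdeg e).+1 c.
  rewrite mcoeffB (normal_ia_coef_indep pn phix ij (oj j) ec) subrr.
  exact: scale0r.
have -> : ad_monomial x e [lie x i, x j] = 0; last exact: scaler0.
apply: (@mn_lcs_eq0 _ _ _ (1 + mdeg e).+1) => //.
by apply: ad_monomial_lcs; exact: lcs2_bracket.
Qed.

End NormalIAGeneralized.

(** * Two generators: scalings, generalized inner and inner automorphisms *)

Lemma lcs_bracket2 (K : fieldType) (L : lieAlgType K) k (u v : L) :
  @lcs _ L k.+1 u -> @lcs _ L 2 v -> @lcs _ L k.+3 [lie u, v].
Proof.
move=> Lu; move: v; apply: sub_bracket_space => [|v w _ _].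
  split=> [|a v w Lv Lw]; first by rewrite lieb0r; exact: lcs0.
  by rewrite liebDr liebZr; apply: (lcs_subspace L k.+3).2.
by rewrite lieb_leibnizr; apply: lcsB; do 2!apply: lcsS_bracket.
Qed.

Section Scaling.
Variables (K : fieldType) (m c : nat).
Local Notation L := (free_mn K m c).

(** The graded pieces of the lower central series are generated by
    [L / L'] under brackets, so [phi] acts by [a ^ k] on the [k]-th one. *)
Lemma scalar_mod_lcs (phi : lie_aut L) a k u : scalar_mod_derived phi a ->
  @lcs _ L k.+1 u -> @lcs _ L k.+2 (phi u - a ^+ k.+1 *: u).
Proof.
move=> pa; have ph := aut_hom phi; elim: k u => [|k IHk] u;
  first by rewrite expr1.
apply: (@sub_bracket_space _ _ _ _ [set v | @lcs _ L k.+3 (phi v -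
  a ^+ k.+2 *: v)]).
  split=> [|b v w Lv Lw] /=; first by rewrite (lie_hom0 ph) scaler0 subr0;
    exact: lcs0.
  rewrite ph.1 scalerDr scalerA mulrC -scalerA opprD addrACA -scalerBr.
  by apply: (lcs_subspace L k.+3).2.
move=> {}u v Lu _ /=.
have -> : phi [lie u, v] - a ^+ k.+2 *: [lie u, v] =
    [lie phi u - a ^+ k.+1 *: u, phi v] + a ^+ k.+1 *: [lie u, phi v - a *: v].
  rewrite ph.2 liebBl liebBr liebZl liebZr scalerBr scalerA -exprSr.
  by rewrite addrA subrK.
apply: lcsD; first by apply: lcsS_bracket; exact: IHk.
by apply: lcsZ; apply: lcs_bracket2 => //; exact: pa.
Qed.

Lemma scaling_normal_of_closed :
  (forall (a : Kunit K) (I : set L) u, lie_ideal I -> I u ->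
    I (scaling K m c a u)) ->
  forall a, normal_aut L (scaling K m c a).
Proof.
move=> sI a I Ii; apply/seteqP; split=> [_ [u Iu <-]|u Iu]; first exact: sI.
exists (scaling K m c a^-1%g u); first exact: sI.
by rewrite sd_actV; exact: aut_mulKV.
Qed.

End Scaling.

Lemma scaling_normal_abelian (K : fieldType) m (a : Kunit K) :
  normal_aut (free_mn K m 1) (scaling K m 1 a).
Proof.
apply: scaling_normal_of_closed => {}a I u [Is _] Iu.
have := scalar_mod_derived_scaling (m := m) (c := 1) a u.
by move/(mn_lcs_eq0 (ltnSn 1))/subr0_eq => ->; exact: subspaceZ.
Qed.

Section TwoGenerators.
Variables (K : fieldType) (c : nat).
Local Notation L := (free_mn K 2 c).
Local Notation x := (@mn_gen K 2 c).
Local Notation i0 := (ord0 : 'I_2).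
Local Notation i1 := (lift ord0 ord0 : 'I_2).
Local Notation z := [lie x i0, x i1].
Let gen : lie_generates x := @mn_gen_generates K 2 c.

Lemma ord2P (i : 'I_2) : i = i0 \/ i = i1.
Proof. by case: i => -[|[|//]] lti; [left | right]; apply: val_inj. Qed.

Lemma derived_sub (I : set L) : lie_ideal I -> I z -> @lcs _ L 2 `<=` I.
Proof.
move=> Ii Iz; have [Is _] := Ii; apply: (lcs2_sub gen Ii) => i j.
case: (ord2P i) => ->; case: (ord2P j) => -> //; rewrite ?liebvv;
  try by case: Is.
by rewrite liebC; exact: subspaceN.
Qed.

Lemma lcs3_sub (I : set L) :
  lie_ideal I -> (forall i, I [lie z, x i]) -> @lcs _ L 3 `<=` I.
Proof.
move=> Ii Iz; have Ji := lie_ideal_bracket_in Ii.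
have Jz := derived_sub Ji (bracket_gen_sub gen Ii Iz).
by apply: sub_bracket_space => [|u v /Jz Iu _]; [case: Ii | exact: Iu].
Qed.

Lemma derived_mod_lcs3 u : @lcs _ L 2 u -> exists b, @lcs _ L 3 (u - b *: z).
Proof.
move: u; apply: derived_sub; last by exists 1; rewrite scale1r subrr;
  exact: lcs0.
split; [split=> [|a u v [b Lu] [d Lv]]|move=> u v [b Lu]].
- by exists 0; rewrite scale0r subr0; exact: lcs0.
- exists (a * b + d); rewrite scalerDl -scalerA opprD addrACA -scalerBr.
  exact: (lcs_subspace L 3).2.
- exists 0; rewrite scale0r subr0 -[u](subrK (b *: z)) liebDl liebZl.
  apply: lcsD; first by apply: (@lcsS_sub _ _ 3); exact: lcsS_bracket.
  by apply: lcsZ; apply: lcsS_bracket; exact: lcs2_bracket.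
Qed.

Lemma derived_cyclic u : @lcs _ L 2 u -> exists f, u = ad_poly x f z.
Proof.
move: u; apply: derived_sub; last by exists 1; rewrite ad_poly1.
exact: cyclic_ideal_derived (lcs2_bracket _ _).
Qed.

(** For [i <> j] each of [phi x_i - x_i] is a multiple of [z = [x_i, x_j]] by
    a polynomial, and for two generators no compatibility between the two
    polynomials is required. *)
Lemma ia_ginner_two : [set phi | scalar_mod_derived phi 1] `<=` @ginner_aut K
  2 c.
Proof.
move=> phi p1.
have [f0 f0E] := derived_cyclic (p1 (x i0)).
have [f1 f1E] := derived_cyclic (p1 (x i1)).
exists (fun j => if j == i0 then - f1 else f0) => i.
rewrite !big_ord_recl big_ord0 addr0 eqxx /=.
have -> : phi (x i) = x i + (phi (x i) -
  1 *: x i) by rewrite scale1r addrC subrK.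
congr (_ + _); case: (ord2P i) => ->.
  by rewrite f0E liebvv ad_poly0r add0r.
by rewrite f1E liebvv ad_poly0r addr0 [[lie x i1, _]]liebC ad_polyNr ad_polyNl
  opprK.
Qed.

Lemma ginner_two : @ginner_aut K 2 c = @normal_ia_aut K 2 c.
Proof.
apply/seteqP; split; first exact: ginner_normal_ia.
by move=> phi [_ p1]; exact: ia_ginner_two.
Qed.

(** Take [u] in an ideal [I].  If [u] is not in [L'], then brackets of [u]
    produce [z] up to [L^3], then all of [L^3], and hence [L'] lies in [I].  If
    [u] is in [L'] but not in [L^3], then [L^3] lies in [I].  If [u] is in
    [L^3], it is homogeneous.  In each case [scaling a u] is a multiple of [u]
    modulo a term of the lower central series contained in [I]. *)
Lemma scaling_normal_two (a : Kunit K) : (c <= 3)%N ->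
  normal_aut L (scaling K 2 c a).
Proof.
move=> c3; apply: scaling_normal_of_closed => {}a I u Ii Iu.
have [Is Ib] := Ii.
have sa := scalar_mod_derived_scaling (m := 2) (c := c) a.
have L4 w : @lcs _ L 4 w -> w = 0 by apply: mn_lcs_eq0.
have close k b w : I w -> @lcs _ L k (scaling K 2 c a w - b *: w) ->
    @lcs _ L k `<=` I -> I (scaling K 2 c a w).
  move=> Iw Lw kI; rewrite -[scaling _ _ _ _ _](subrK (b *: w)).
  by apply: subspaceD => //; [exact: kI | exact: subspaceZ].
have [b bu] := gen_mod_lcs2 gen u.
rewrite big_ord_recl big_ord1 in bu.
have [/orP bn0|] := boolP ((b i0 != 0) || (b i1 != 0)).
  apply: (close 2%N (uval a)) => //; apply: derived_sub => //.
  have ux i : exists2 d, @lcs _ L 3 d &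
      [lie u, x i] = (if i == i0 then - b i1 else b i0) *: z + d.
    exists [lie u - (b i0 *: x i0 + b i1 *: x i1), x i];
      first exact: lcsS_bracket.
    rewrite -{1}[u](subrK (b i0 *: x i0 + b i1 *: x i1)) liebDl addrC.
    congr (_ + _); rewrite liebDl !liebZl; case: (ord2P i) => -> /=.
      by rewrite liebvv scaler0 add0r liebC scalerN scaleNr.
    by rewrite liebvv scaler0 addr0.
  have [i [g g0 [d Ld uE]]] : exists i, exists2 g, g != 0 & exists2 d,
      @lcs _ L 3 d & [lie u, x i] = g *: z + d.
    case: bn0 => bn0; first by exists i1, (b i0); last exact: (ux i1).
    by exists i0, (- b i1); [rewrite oppr_eq0 | exact: (ux i0)].
  have Iui : I [lie u, x i] by exact: Ib.
  have L3I : @lcs _ L 3 `<=` I.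
    apply: lcs3_sub => // j; have := Ib _ (x j) Iui.
    rewrite uE liebDl liebZl (L4 [lie d, x j]) ?addr0; last exact: lcsS_bracket.
    by move/(subspaceZ g^-1 Is); rewrite scalerA mulVf // scale1r.
  have : I (g *: z).
    by rewrite -[_ *: z](addrK d) -uE; apply: subspaceB => //; exact: L3I.
  by move/(subspaceZ g^-1 Is); rewrite scalerA mulVf // scale1r.
rewrite negb_or !negbK => /andP[/eqP b0 /eqP b1].
have Lu : @lcs _ L 2 u by move: bu; rewrite b0 b1 !scale0r addr0 subr0.
have [g gu] := derived_mod_lcs3 Lu.
have [g0|g0] := eqVneq g 0.
  rewrite g0 scale0r subr0 in gu.
  apply: (close 4%N (uval a ^+ 3)) => //; first exact: scalar_mod_lcs.
  by move=> w /L4 ->; case: Is.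
apply: (close 3%N (uval a ^+ 2)) => //; first exact: scalar_mod_lcs.
apply: lcs3_sub => // j; have := Ib _ (x j) Iu.
rewrite -[u](subrK (g *: z)) liebDl (L4 [lie u - _, _]);
  last exact: lcsS_bracket.
rewrite add0r liebZl.
by move/(subspaceZ g^-1 Is); rewrite scalerA mulVf // scale1r.
Qed.

Lemma inner_ia : inner_aut L `<=` [set phi | scalar_mod_derived phi 1].
Proof.
move=> phi [v pv] u; have [N /(_ N.+1 (leqnSn N)) ->] := pv u.
rewrite big_ord_recl /= fact0 invr1 !scale1r addrC addKr.
apply: (subspace_sum (lcs_subspace L 2)) => k _; apply: lcsZ.
by rewrite /bump /=; exact: lcs2_bracket.
Qed.

End TwoGenerators.

Section Heisenberg.
Variable K : fieldType.
Local Notation L := (free_mn K 2 2).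
Local Notation x := (@mn_gen K 2 2).

(** In class 2, [exp (ad v) = 1 + ad v], and [ad v] takes arbitrary central
    values on [x_1] and [x_2] as [v] varies. *)
Lemma inner_heisenberg : inner_aut L = @normal_ia_aut K 2 2.
Proof.
apply/seteqP; split.
  by rewrite -ginner_two => phi /inner_ia; exact: ia_ginner_two.
move=> phi [_ p1].
have L3 (u : L) : @lcs _ L 3 u -> u = 0 by exact: mn_lcs_eq0.
have ex i : exists b, phi (x i) = x i + b *: [lie x ord0, x (lift ord0 ord0)].
  have [b /L3/subr0_eq bE] := derived_mod_lcs3 (p1 (x i)).
  by exists b; rewrite -bE scale1r addrC subrK.
have [b0 e0] := ex ord0; have [b1 e1] := ex (lift ord0 ord0).
have vh (v : L) : lie_hom (fun u : L => u + [lie u, v]).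
  split=> [a w w'|w w']; first by rewrite liebDl liebZl scalerDr addrACA.
  have br2 (w1 w2 w3 : L) : [lie [lie w1, w2], w3] = 0.
    by apply: L3; apply: lcsS_bracket; exact: lcs2_bracket.
  rewrite /= br2 addr0 liebDl !liebDr !br2 [[lie w, [lie w', v]]]liebC br2
    oppr0.
  by rewrite !addr0.
(* [x_0, v] = b0 z and [x_1, v] = - b1 [x_1, x_0] = b1 z *)
pose v := b0 *: x (lift ord0 ord0) - b1 *: x ord0.
exists v => u; exists 2%N => -[|[|n]] // _.
have -> : phi u = u + [lie u, v].
  move: u; apply: (mn_hom_ext (aut_hom phi) (vh v)) => i.
  rewrite liebBr !liebZr; case: (ord2P i) => ->.
    by rewrite [LHS]e0 liebvv scaler0 subr0.
  by rewrite [LHS]e1 liebvv scaler0 sub0r [[lie x (lift _ _), _]]liebC scalerN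
    opprK.
rewrite !big_ord_recl /= fact0 invr1 !scale1r big1 ?addr0 => // k _.
rewrite [X in _ *: X](_ : _ = 0) ?scaler0 //.
by apply: L3; apply: lcsS_bracket; exact: lcs2_bracket.
Qed.

End Heisenberg.

(** * Ideals that mix degrees force the scalar to be 1 *)

(** The model sees an automorphism of scalar [a] only through [a] and an
    error divisible by [T] in the first coordinate. *)
Lemma aff_image_scalar (K : fieldType) m c d (phi : lie_aut (free_mn K m c)) a
    (rho : free_mn K m c -> lie_quot (aff_trunc K d)) u (y : aff K) :
  scalar_mod_derived phi a -> lie_hom rho ->
    rho u = quot_pi (aff_trunc K d) y ->
  exists p, rho (phi u) = quot_pi (aff_trunc K d) (a *: y + ('X * p, 0)).
Proof.
move=> pa rh ry; have [p pE] := aff_hom_lcs2 rh (pa u).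
have pih := quot_pi_hom (aff_trunc K d).
exists p; rewrite (lie_homD pih) (lie_homZ pih) -ry -pE.
by rewrite (lie_homB rh) (lie_homZ rh) addrC subrK.
Qed.

(** Let [rho] be the homomorphism to the Heisenberg algebra with
    [x_2 |-> X], [x_3 |-> Y], [x_1 |-> - [X, Y]] and the other generators sent
    to 0.  It kills [x_1 + [x_2, x_3]], and it kills the part of the ideal of
    [x_1] inside [L'].  So [- a [X, Y] + a^2 [X, Y] = 0]. *)
Lemma scalar_one_three (K : fieldType) m c (phi : lie_aut (free_mn K m c)) a :
  (3 <= m)%N -> (2 <= c)%N -> normal_aut (free_mn K m c) phi ->
  scalar_mod_derived phi a -> a != 0 -> a = 1.
Proof.
move=> m3 c2 pn pa a0.
pose j1 : 'I_m := Ordinal (leq_trans (isT : 0 < 3)%N m3).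
pose j2 : 'I_m := Ordinal (leq_trans (isT : 1 < 3)%N m3).
pose j3 : 'I_m := Ordinal (leq_trans (isT : 2 < 3)%N m3).
pose y (l : 'I_m) : aff K :=
  if l == j1 then (- 'X, 0) else if l == j2 then (1, 0)
  else if l == j3 then (0, 1) else 0.
have [rho rh rx] := aff_hom_exists y (d := 2) c2.
pose x := mn_gen K c : 'I_m -> _.
have ph := aut_hom phi.
have pih := quot_pi_hom (aff_trunc K 2).
have c0 : (0 < c)%N by apply: leq_trans c2.
have rho1 : rho (phi (x j1)) = quot_pi _ (a *: y j1).
  have [f fE] := normal_gen_expand j1 c0 pn pa.
  rewrite [phi _]fE (lie_homD rh) (lie_homZ rh) rx -(lie_homZ pih).
  rewrite lie_hom_sum // big1 ?addr0 // => j _.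
  apply: (@ad_poly_ideal _ _ _ _ [set u | rho u =
    0] _ _ (lie_ideal_ker rh)) => /=.
  rewrite rh.2 !rx -pih.2 -(lie_hom0 pih); apply/aff_piP.
  have -> : y j1 = (- 'X, 0) by rewrite /y eqxx.
  case: (y j) => p q.
  split=> //=; have -> : 'X * (- 'X * q - p * 0) - 0 = 'X^2 * - q by ring.
  exact: dvdp_mulr.
have [p2 rho2] := aff_image_scalar pa rh (rx j2).
have [p3 rho3] := aff_image_scalar pa rh (rx j3).
have /(normal_aut_closed pn (lie_ideal_ker rh)) /= :
    rho (x j1 + [lie x j2, x j3]) = 0.
  rewrite (lie_homD rh) rh.2 !rx -pih.2 -(lie_homD pih) -(lie_hom0 pih).
  congr quot_pi; rewrite aff_liebE /y /=; congr (_, _) => /=;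
    last by rewrite addr0.
  by rewrite mulr0 subr0 !mulr1 addNr.
rewrite (lie_homD ph) ph.2 (lie_homD rh) rh.2 rho1 rho2 rho3 -pih.2.
rewrite -(lie_homD pih) -(lie_hom0 pih) => /aff_piP[+ _].
rewrite aff_liebE /y /= => dvd; have := dvdXn_coef dvd (isT : (1 < 2)%N).
rewrite subr0 -!mul_polyC.
have -> : a%:P * - 'X + 'X * ((a%:P * 1 + 'X * p2) * (a%:P * 1 + 0) -
    (a%:P * 0 + 'X * p3) * (a%:P * 0 + 0)) = 'X^1 * ((a ^+ 2 -
      a)%:P + 'X * (p2 * a%:P)).
  rewrite polyCB rmorphXn /= expr1; ring.
rewrite coefXnM /= subnn coefD coefC coefXM addr0 /=.
move/eqP; rewrite expr2 -{3}[a]mulr1 -mulrBr mulf_eq0 (negPf a0) subr_eq0.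
by move/eqP.
Qed.

(** Take [x_1 |-> (1, - T)] and [x_2 |-> (0, 1)], so that [x_1] acts on
    [L'] as [- x_2^2] does.  Then [w x_1 x_2] is killed although its two
    terms, of degrees 3 and 4, are not; the image of [phi] on it has
    leading coefficient [(a - 1) a^3] at [T^3]. *)
Lemma scalar_one_two (K : fieldType) c (phi : lie_aut (free_mn K 2 c)) a :
  (4 <= c)%N -> normal_aut (free_mn K 2 c) phi ->
  scalar_mod_derived phi a -> a != 0 -> a = 1.
Proof.
move=> c4 pn pa a0; set j1 : 'I_2 := ord0; set j2 : 'I_2 := lift ord0 ord0.
pose y (l : 'I_2) : aff K := if l == j1 then (1, - 'X) else (0, 1).
have [rho rh rx] := aff_hom_exists y (d := 4) c4.
have ph := aut_hom phi.
have pih := quot_pi_hom (aff_trunc K 4).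
have [p1 rho1] := aff_image_scalar pa rh (rx j1).
have [p2 rho2] := aff_image_scalar pa rh (rx j2).
pose w (u v : free_mn K 2 c) :=
  [lie [lie u, v], u] + [lie [lie [lie u, v], v], v].
have /(normal_aut_closed pn (lie_ideal_ker rh)) /= :
    rho (w (mn_gen K c j1) (mn_gen K c j2)) = 0.
  rewrite /w (lie_homD rh) !rh.2 !rx -!pih.2 -(lie_homD pih) -(lie_hom0 pih).
  by congr quot_pi; rewrite !aff_liebE /y /=; congr (_, _) => /=; ring.
rewrite /w (lie_homD ph) !ph.2 (lie_homD rh) !rh.2 rho1 rho2 -!pih.2.
rewrite -(lie_homD pih) -(lie_hom0 pih) => /aff_piP[+ _].
rewrite !aff_liebE /y /= => dvd; have := dvdXn_coef dvd (isT : (3 < 4)%N).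
rewrite subr0 -!mul_polyC.
set T := 'X * _ + 'X * _; have -> : T = 'X^3 * (((a ^+ 2 - a) * a ^+ 2)%:P +
    'X * ((a ^+ 2 - a)%:P * (p1 * a%:P + a%:P * p2 * 'X))).
  by rewrite /T polyCM !polyCB !rmorphXn /=; ring.
rewrite coefXnM /= subnn coefD coefC coefXM addr0 /=.
move/eqP; rewrite mulf_eq0 expf_eq0 (negPf a0) orbF.
by rewrite expr2 -{3}[a]mulr1 -mulrBr mulf_eq0 (negPf a0) subr_eq0 => /eqP.
Qed.

(** * The normal automorphism groups *)

Lemma normal_ia_ginnerE (K : fieldType) (charK : [pchar K] =i pred0) m c :
  (2 <= m)%N -> (0 < c)%N -> @normal_ia_aut K m c = @ginner_aut K m c.
Proof.
move=> m2 c0; apply/seteqP; split; last exact: ginner_normal_ia.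
have [m3|] := ltnP 2 m; first exact: normal_ia_ginner.
by case: m m2 => [|[|[|m]]] // _ _; rewrite ginner_two.
Qed.

Theorem corollary3p5 (K : fieldType) (charK : [pchar K] =i pred0) :
  [/\ forall m : nat, (2 <= m)%N ->
        group_iso (normal_aut (free_mn K m 1)) [set: Kunit K],
      group_iso (normal_aut (free_mn K 2 2))
        (sdprod (scaling K 2 2) (inner_aut (free_mn K 2 2))),
      group_iso (normal_aut (free_mn K 2 3))
        (sdprod (scaling K 2 3) (ginner_aut K 2 3))
    & forall m c : nat,
        ((3 <= m)%N /\ (2 <= c)%N) \/ (m = 2%N /\ (4 <= c)%N) ->
        normal_aut (free_mn K m c) = ginner_aut K m c].
Proof.
split=> [m m2|||m c mc].
- by apply: normal_aut_units => // a; exact: scaling_normal_abelian.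
- rewrite inner_heisenberg; apply: normal_aut_sdprod => // a.
  exact: scaling_normal_two.
- rewrite ginner_two; apply: normal_aut_sdprod => // a.
  exact: scaling_normal_two.
have [m2 c2] : (2 <= m)%N /\ (2 <= c)%N.
  by case: mc => [[m3 ->]|[-> c4]]; split=> //;
    [exact: ltnW | exact: leq_trans c4].
rewrite -(normal_ia_ginnerE charK m2 (ltnW c2)); apply/seteqP;
  split=> [phi pn|phi []//].
split=> //; have [a pa] := normal_aut_scalar m2 (ltnW c2) pn.
suff <- : uval a = 1 by [].
have a0 : uval a != 0 by rewrite -unitfE; exact: uvalP.
case: mc => [[m3 _]|[m2E c4]]; first exact: scalar_one_three m3 c2 pn pa a0.
by subst m; exact: scalar_one_two c4 pn pa a0.
Qed.
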